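(* Let $0<\alpha<1$, let $\lambda_{\star}=\frac{1-\alpha}{\sqrt{(1-\alpha)^{2}+\alpha^{2}}}$, let $0<\lambda\le\lambda_\star$, and let $f(z)=z+a_{2}z^{2}+a_{3}z^{3}+\cdots$ belong to the class $\mathcal{U}(\alpha,\lambda)$, with logarithmic coefficients $\gamma_1,\gamma_2,\gamma_3$. Then the following hold. (i) $|\gamma_{1}|\leq \frac{\lambda}{2(1-\alpha)}$ whenever $0<\lambda\leq \lambda_{\star}$ and $0<\alpha<1$. (ii) Let $\lambda_{1}=\frac{2(1-\alpha)^{2}}{\alpha(2-\alpha)}$ and let $\alpha_{1}=0.4825\ldots$ be the unique real root of the equation $$7\alpha^{4}-20\alpha^{3}+24\alpha^{2}-16\alpha+4=0$$ on the interval $(0,1)$. Then $$|\gamma_{2}|\leq \frac{\lambda}{2(2-\alpha)}\quad\text{if}\quad 0<\lambda\leq \begin{cases}\lambda_{1}, & \alpha\in[\alpha_{1},1),\\ \lambda_{\star}, & \alpha\in(0,\alpha_{1}],\end{cases}$$ and $$|\gamma_{2}|\leq \frac{\alpha\lambda^{2}}{4(1-\alpha)^{2}}\quad\text{if}\quad \lambda_{1}\leq\lambda\leq\lambda_{\star},\ \alpha\in[\alpha_{1},1).$$ (iii) Let $\lambda_{1/2}=\frac{(1-\alpha)(2-\alpha)}{2\alpha(3-\alpha)}$ and $\lambda_{\nu}=\sqrt{\frac{3(1-\alpha)^{3}}{\alpha^{2}(3-\alpha)}}$. Let $\alpha_{1/2}=0.2512\ldots$ and $\alpha_{\nu}=0.5337\ldots$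 be the unique roots on the interval $(0,1)$ of the equations $$4-12\alpha-19\alpha^{2}+14\alpha^{3}-2\alpha^{4}=0\quad\text{and}\quad 3-9\alpha+9\alpha^{2}-5\alpha^{3}=0,$$ respectively, and let $\alpha_{2}=0.9555\ldots$ be the unique real root of the equation $11\alpha^{2}-44\alpha+32=0$ on $(0,1)$. Then $$|\gamma_{3}|\leq \frac{\lambda}{2(3-\alpha)}\quad\text{if}\quad 0<\lambda\leq\begin{cases}\lambda_{\star}, & \alpha\in(0,\alpha_{1/2}],\\ \lambda_{1/2}, & \alpha\in[\alpha_{1/2},\alpha_{2}],\\ \lambda_{\nu}, & \alpha\in[\alpha_{2},1),\end{cases}$$ and $$|\gamma_{3}|\leq \frac{\alpha^{2}\lambda^{3}}{6(1-\alpha)^{3}}\quad\text{if}\quad \lambda_{\nu}\leq\lambda\leq\lambda_{\star},\ \alpha\in[\alpha_{\nu},1).$$ Moreover, all of these results are best possible: for each pair $(\alpha,\lambda)$ in the range stated for a given bound, the right-hand side of that bound cannot be replaced by any smaller number (valid for all $f\in\mathcal{U}(\alpha,\lambda)$).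
   Context: Let $\mathbb{D}=\{z\in\mathbb{C}:|z|<1\}$ and let $\mathcal{A}$ be the class of functions $f$ analytic in $\mathbb{D}$ of the form $f(z)=z+a_2z^2+a_3z^3+\cdots$. For $0<\alpha<1$ and $0<\lambda<1$, the class $\mathcal{U}(\alpha,\lambda)$ consists of the functions $f\in\mathcal{A}$ satisfying $$\left|\left(\frac{z}{f(z)}\right)^{1+\alpha}f'(z)-1\right|<\lambda\quad\text{for all } z\in\mathbb{D}.$$ Here it is understood that $f(z)\neq 0$ for $z\in\mathbb{D}\setminus\{0\}$, that $z/f(z)$ takes the value $1$ at $z=0$, and that the power is the analytic branch on $\mathbb{D}$ equal to $1$ at $z=0$. The logarithmic coefficients $\gamma_n$, $n=1,2,\ldots$, of $f$ are defined by $$\log\frac{f(z)}{z}=2\sum_{n=1}^{\infty}\gamma_n z^n,$$ where the logarithm is the analytic branch on $\mathbb{D}$ vanishing at $z=0$. (It is known that for $0<\lambda\le\lambda_\star$ functions in $\mathcal{U}(\alpha,\lambda)$ are starlike, hence univalent, in $\mathbb{D}$.) In parts (ii) and (iii), $\lambda_\star,\lambda_1,\lambda_{1/2},\lambda_\nu$ are functions of the parameter $\alpha$ of the class, while $\alpha_1,\alpha_{1/2},\alpha_\nu,\alpha_2$ are absolute constants. *)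

(* Defs.v *)
From Stdlib Require Import Reals.
From Coquelicot Require Import Coquelicot.
Open Scope R_scope.

Definition in_disk (z : C) : Prop := Cmod z < 1.

(* Complex differentiability: the derivative is taken over the scalar field C. *)
Definition analytic_on_disk (f : C -> C) : Prop :=
  forall z : C, in_disk z -> @ex_derive C_AbsRing C_NormedModule f z.

(* Functions are total on C; only their values on the disk matter. *)
Definition class_A (f : C -> C) : Prop :=
  analytic_on_disk f /\
  exists a : nat -> C, a 0%nat = RtoC 0 /\ a 1%nat = RtoC 1 /\
    forall z : C, in_disk z -> @is_pseries C_AbsRing C_NormedModule a z (f z).

Definition Cexp (z : C) : C :=
  (exp (Re z) * cos (Im z), exp (Re z) * sin (Im z)).

Definition id_over (f : C -> C) (z : C) : C :=
  if Ceq_dec z (RtoC 0) then RtoC 1 else (z / f z)%C.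

Definition over_id (f : C -> C) (z : C) : C :=
  if Ceq_dec z (RtoC 0) then RtoC 1 else (f z / z)%C.

(* Such an L is unique on the disk, by connectedness; it exists whenever g is
   analytic and zero-free on the disk with g 0 = 1. *)
Definition log_branch (g L : C -> C) : Prop :=
  analytic_on_disk L /\ L (RtoC 0) = RtoC 0 /\
  forall z : C, in_disk z -> Cexp (L z) = g z.

(* h is the analytic branch on the disk of the power g ^ s with h 0 = 1. *)
Definition power_branch (g : C -> C) (s : R) (h : C -> C) : Prop :=
  exists L : C -> C, log_branch g L /\
    forall z : C, in_disk z -> h z = Cexp (RtoC s * L z)%C.

Definition class_U (alpha lambda : R) (f : C -> C) : Prop :=
  class_A f /\
  (forall z : C, in_disk z -> z <> RtoC 0 -> f z <> RtoC 0) /\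
  exists h : C -> C, power_branch (id_over f) (1 + alpha) h /\
    forall z : C, in_disk z ->
      Cmod (h z * C_derive f z - RtoC 1)%C < lambda.

(* The coefficients are indexed from 1: the value gamma 0 is irrelevant. *)
Definition log_coeffs (f : C -> C) (gamma : nat -> C) : Prop :=
  exists L : C -> C, log_branch (over_id f) L /\
    forall z : C, in_disk z ->
      exists s : C,
        @is_series C_AbsRing C_NormedModule
          (fun k : nat => (gamma (S k) * z ^ S k)%C) s /\
        L z = (RtoC 2 * s)%C.

Definition coeff_bound (alpha lambda : R) (n : nat) (B : R) : Prop :=
  forall (f : C -> C) (gamma : nat -> C),
    class_U alpha lambda f -> log_coeffs f gamma -> Cmod (gamma n) <= B.

Definition best_coeff_bound (alpha lambda : R) (n : nat) (B : R) : Prop :=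
  coeff_bound alpha lambda n B /\
  forall M : R, coeff_bound alpha lambda n M -> B <= M.

Definition lambda_star (a : R) : R := (1 - a) / sqrt ((1 - a) ^ 2 + a ^ 2).
Definition lambda_1 (a : R) : R := 2 * (1 - a) ^ 2 / (a * (2 - a)).
Definition lambda_half (a : R) : R :=
  (1 - a) * (2 - a) / (2 * a * (3 - a)).
Definition lambda_nu (a : R) : R :=
  sqrt (3 * (1 - a) ^ 3 / (a ^ 2 * (3 - a))).

Definition unique_root_01 (p : R -> R) (r : R) : Prop :=
  (0 < r < 1 /\ p r = 0) /\
  forall x : R, 0 < x < 1 -> p x = 0 -> x = r.

(* Main.v *)
(** Writing [L = log (f(z)/z) = sum l_k z^k], so that [l_k = 2 gamma_k], the
    defining quantity of the class is [exp (- alpha L) (1 + z L') - 1].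
    It is bounded by [lambda] on the disk and has Taylor coefficients
    [(1 - alpha) l_1], [(2 - alpha) (l_2 - alpha l_1^2 / 2)] and
    [(3 - alpha) (l_3 - alpha l_1 l_2 + alpha^2 l_1^3 / 6)].

    Multiplication by a function [w] bounded by 1 contracts the L^2 norm on
    circles, which constrains the coefficients [c_1, c_2, c_3] of [w] when
    [w 0 = 0].  Testing on [1 / (1 - w)] and [1 / (1 + w)] truncated after
    degree 2 gives [|c_2 + c_1^2| <= 1] and [|c_3 +- 2 c_1 c_2 + c_1^3| <= 1];
    together with Bessel's inequality and convexity this yields the needed cases
    of the Fekete-Szego and Prokhorov-Szynal inequalities.

    The bounds are attained by [f = z (1 - k z^n)^(-1/alpha)] with
    [k = alpha lambda / (n - alpha)], for which that quantity is [lambda z^n]. *)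

Require Import Defs.
From Stdlib Require Import Reals Lra Lia Psatz Arith List.
From Coquelicot Require Import Coquelicot.
Open Scope R_scope.

(** No contour integral is used. For a polynomial on the unit circle, the squared modulus is at
    least the sum of the squared moduli of its first coefficients plus a term [Re (w * G w)] with
    [G] polynomial, and such a term averages to 0 over enough roots of unity. A function on the disk
    is reached through polynomials that are uniformly close on smaller disks and have exactly its
    coefficients up to degree 3, so no coefficient has to pass to a limit.

    After division by [lambda], [gamma 2] and [gamma 3] are multiples of [c2 + t c1^2] and
    [c3 + mu c1 c2 + nu c1^3]. The thresholds are the values of [lambda] where these parameters
    become critical: [lambda_1] is [t = 1], [lambda_half] is [mu = 1/2], [lambda_nu] is [nu = 1].
    Each constant alpha with an index is the point where two of the thresholds cross. The bound by
    [lambda_star] also gives [alpha * lambda < 1 - alpha], which keeps [k z^n] inside the disk for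
    the extremal functions, and [mu <= 2], which the last estimate requires. *)

(** * Complex differentiation *)

Definition Cder (f : C -> C) (z l : C) : Prop :=
  @is_derive C_AbsRing C_NormedModule f z l.

(* The two normed-module structures on [C] differ only in their topology, which
   is not part of [is_derive]. *)
Lemma Cder_R (f : C -> C) z l :
  @is_derive C_AbsRing (AbsRing_NormedModule C_AbsRing) f z l <-> Cder f z l.
Proof.
split; intros [H1 H2]; split; try exact H2.
- destruct H1 as [A B M]; constructor; [exact A|exact B|exact M].
- destruct H1 as [A B M]; constructor; [exact A|exact B|exact M].
Qed.

Lemma Cder_comp (f g : C -> C) z df dg :
  Cder f (g z) df -> Cder g z dg -> Cder (fun w => f (g w)) z (dg * df)%C.
Proof.
intros Hf Hg. apply Cder_R in Hg.
exact (is_derive_comp f g z df dg Hf Hg).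
Qed.

Lemma Cder_mult (f g : C -> C) z df dg :
  Cder f z df -> Cder g z dg ->
  Cder (fun w => f w * g w)%C z (df * g z + f z * dg)%C.
Proof.
intros Hf Hg. apply Cder_R in Hf; apply Cder_R in Hg. apply Cder_R.
exact (is_derive_mult f g z df dg Hf Hg Cmult_comm).
Qed.

Lemma Cder_id z : Cder (fun w => w) z (RtoC 1).
Proof. apply Cder_R. exact (is_derive_id z). Qed.

Lemma Cder_const c z : Cder (fun _ => c) z (RtoC 0).
Proof. exact (is_derive_const (K := C_AbsRing) (V := C_NormedModule) c z). Qed.

Lemma Cder_plus (f g : C -> C) z df dg :
  Cder f z df -> Cder g z dg -> Cder (fun w => f w + g w)%C z (df + dg)%C.
Proof. exact (is_derive_plus (K := C_AbsRing) (V := C_NormedModule) f g z df dg). Qed.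

Lemma Cder_scal c (f : C -> C) z df :
  Cder f z df -> Cder (fun w => c * f w)%C z (c * df)%C.
Proof.
intros Hf.
replace (c * df)%C with (RtoC 0 * f z + c * df)%C by ring.
exact (Cder_mult (fun _ => c) f z _ _ (Cder_const c z) Hf).
Qed.

Lemma Cder_pow n z : Cder (fun w => w ^ S n)%C z (INR (S n) * z ^ n)%C.
Proof.
induction n as [|n IH].
- replace (INR 1 * z ^ 0)%C with (RtoC 1 * RtoC 1 + z * RtoC 0)%C by (simpl; ring).
  exact (Cder_mult _ _ z _ _ (Cder_id z) (Cder_const (RtoC 1) z)).
- replace (INR (S (S n)) * z ^ S n)%C
    with (RtoC 1 * z ^ S n + z * (INR (S n) * z ^ n))%C.
  + exact (Cder_mult _ _ z _ _ (Cder_id z) IH).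
  + rewrite (S_INR (S n)), RtoC_plus. simpl; ring.
Qed.

Lemma Cder_eps (f : C -> C) z l :
  Cder f z l <->
  forall eps, 0 < eps -> exists d, 0 < d /\ forall w, Cmod (w - z) < d ->
    Cmod (f w - f z - (w - z) * l) <= eps * Cmod (w - z).
Proof.
split.
- intros [_ H] eps He.
  specialize (H z (fun P HP => HP) (mkposreal eps He)).
  destruct H as [d Hd]. exists d; split; [apply cond_pos|].
  intros w Hw. exact (Hd w Hw).
- intros H. split.
  + exact (is_linear_scal_l (K := C_AbsRing) (V := C_NormedModule) l).
  + intros x Hx.
    apply (is_filter_lim_locally_unique (K:=C_AbsRing) (V:=AbsRing_NormedModule C_AbsRing))
        in Hx. subst x.
    intros eps. destruct (H eps (cond_pos eps)) as [d [Hd Hw]].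
    exists (mkposreal d Hd). intros w Hw'. exact (Hw w Hw').
Qed.

Lemma Cder_ext_disk (f g : C -> C) r z l :
  (forall w, Cmod w < r -> f w = g w) -> Cmod z < r -> Cder f z l -> Cder g z l.
Proof.
intros E Hz Hf. apply (is_derive_ext_loc f g z l); [|exact Hf].
assert (Hp : 0 < r - Cmod z) by lra.
exists (mkposreal _ Hp). intros w Hw. apply E.
change (Cmod (w - z) < r - Cmod z) in Hw.
replace w with ((w - z) + z)%C by ring.
eapply Rle_lt_trans; [apply Cmod_triangle|lra].
Qed.

Lemma Cder_unique (f : C -> C) z l l' : Cder f z l -> Cder f z l' -> l = l'.
Proof.
intros H H'. rewrite <- (is_C_derive_unique _ _ _ H). now apply is_C_derive_unique.
Qed.

(** Restriction to a ray turns complex differentiability into one-variable real calculus. [Re] and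
    [Im] are treated together in [K], since only real linearity and the bound by [Cmod] matter. *)
Lemma Cder_ray (f : C -> C) z t l : Cder f (RtoC t * z)%C l ->
  is_derive (fun s : R => Re (f (RtoC s * z)%C)) t (Re (z * l)%C) /\
  is_derive (fun s : R => Im (f (RtoC s * z)%C)) t (Im (z * l)%C).
Proof.
intros H. rewrite !is_derive_Reals.
assert (K : forall p : C -> R, (forall x, Rabs (p x) <= Cmod x) ->
   (forall x y, p (x - y)%C = p x - p y) -> (forall (s : R) x, p (RtoC s * x)%C = s * p x) ->
   derivable_pt_lim (fun s : R => p (f (RtoC s * z)%C)) t (p (z * l)%C)).
{ intros p Hp Hm Hs eps He.
  (* The increment along the ray is [h * z]. The [+ 1] covers [z = 0], and the factor 2 makes the
     final inequality strict. *)
  set (e := eps / (2 * (Cmod z + 1))).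
  pose proof (Cmod_ge_0 z) as Hz0.
  assert (He' : 0 < e) by (apply Rdiv_lt_0_compat; lra).
  destruct (proj1 (Cder_eps _ _ _) H e He') as [d [Hd HH]].
  assert (Hd' : 0 < d / (Cmod z + 1)) by (apply Rdiv_lt_0_compat; lra).
  exists (mkposreal _ Hd'). intros h Hh0 Hh. simpl in Hh.
  specialize (HH (RtoC (t + h) * z)%C).
  replace (RtoC (t + h) * z - RtoC t * z)%C with (RtoC h * z)%C in HH
    by (rewrite RtoC_plus; ring).
  rewrite Cmod_mult, Cmod_R in HH.
  apply Rlt_div_r in Hh; [|lra].
  assert (Hah : 0 < Rabs h) by now apply Rabs_pos_lt.
  assert (HH' := HH ltac:(nra)).
  apply Rmult_lt_reg_r with (Rabs h); [easy|].
  rewrite <- Rabs_mult.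
  replace ((_ / h - _) * h) with (p (f (RtoC (t + h) * z)%C) - p (f (RtoC t * z)%C) - h * p
      (z * l)%C) by (field; easy).
  rewrite <- Hs, <- !Hm. eapply Rle_lt_trans; [apply Hp|].
  replace (RtoC h * (z * l))%C with (RtoC h * z * l)%C by ring.
  eapply Rle_lt_trans; [apply HH'|].
  replace eps with (e * (2 * (Cmod z + 1))) by (unfold e; field; lra).
  assert (0 < e * Rabs h) by (apply Rmult_lt_0_compat; lra). nra. }
split; apply K.
- apply re_le_Cmod.
- reflexivity.
- intros; unfold Re, Im; simpl; ring.
- intros x. eapply Rle_trans; [|apply Rmax_Cmod]. apply Rmax_r.
- reflexivity.
- intros; unfold Re, Im; simpl; ring.
Qed.

(** The real and imaginary parts are constant on the segment from 0 to [z]. This is the uniqueness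
    principle of the development: branches of the logarithm and solutions of differential equations
    are compared through it. *)
Lemma Cder_zero_const (f : C -> C) r z :
  (forall w, Cmod w < r -> Cder f w (RtoC 0)) -> Cmod z < r -> f z = f (RtoC 0).
Proof.
intros H Hz.
assert (D : forall t, 0 <= t <= 1 -> Cder f (RtoC t * z)%C (RtoC 0)).
{ intros t Ht. apply H. rewrite Cmod_mult, Cmod_R, Rabs_pos_eq by lra.
  pose proof (Cmod_ge_0 z). nra. }
assert (D' := fun t Ht => Cder_ray f z t _ (D t Ht)).
rewrite Cmult_0_r in D'.
assert (E : forall p : C -> R, (forall t, 0 <= t <= 1 -> is_derive (fun s : R => p (f (RtoC s
    * z)%C)) t 0) ->
   p (f z) = p (f (RtoC 0))).
{ intros p Hp. symmetry.
  assert (Q := eq_is_derive (fun s : R => p (f (RtoC s * z)%C)) 0 1 Hp Rlt_0_1).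
  simpl in Q. now rewrite Cmult_0_l, Cmult_1_l in Q. }
apply injective_projections.
- apply (E Re). intros t Ht. exact (proj1 (D' t Ht)).
- apply (E Im). intros t Ht. exact (proj2 (D' t Ht)).
Qed.

(** * Complex power series *)

Definition Cis_series (c : nat -> C) (l : C) : Prop :=
  @is_series C_AbsRing C_NormedModule c l.

Lemma Cis_series_eps (c : nat -> C) (l : C) :
  Cis_series c l <->
  forall eps, 0 < eps -> exists N, forall n, (N <= n)%nat ->
    Cmod (@sum_n C_NormedModule c n - l) < eps.
Proof.
split.
- intros H eps He.
  destruct (H _ (locally_le_locally_norm (K:=C_AbsRing) (V:=C_NormedModule) l _
    (locally_norm_ball_norm l (mkposreal eps He)))) as [N HN].
  exists N. intros n Hn. exact (HN n Hn).
- intros H P HP. apply locally_norm_le_locally in HP. destruct HP as [eps HP].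
  destruct (H eps (cond_pos eps)) as [N HN].
  exists N. intros n Hn. apply HP. exact (HN n Hn).
Qed.

Lemma Cpow_n (z : C) k : @pow_n C_Ring z k = (z ^ k)%C.
Proof. induction k as [|k IH]; [reflexivity|]. simpl. now rewrite IH. Qed.

Lemma Cis_pseries (a : nat -> C) z l :
  @is_pseries C_AbsRing C_NormedModule a z l <-> Cis_series (fun k => a k * z ^ k)%C l.
Proof.
split; apply is_series_ext; intros n; rewrite <- (Cpow_n z n); apply Cmult_comm.
Qed.

Lemma Csum_proj (p : C -> R) (Hp : forall x y, p (x + y)%C = p x + p y) (c : nat -> C) n :
  p (@sum_n C_NormedModule c n) = sum_n (fun k => p (c k)) n.
Proof.
induction n as [|n IH].
- now rewrite !sum_O.
- rewrite !sum_Sn, <- IH. apply Hp.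
Qed.

(** A total sum, taken componentwise, so that identities between terms can be rewritten under it;
    [Cser_unique] links it to convergence. *)
Definition Cser (c : nat -> C) : C := (Series (fun k => Re (c k)), Series (fun k => Im (c k))).

Lemma Cser_unique (c : nat -> C) l : Cis_series c l -> Cser c = l.
Proof.
intros H.
assert (K : forall p : C -> R, (forall x y, p (x + y)%C = p x + p y) -> (forall x y, p (x -
    y)%C = p x - p y) ->
  (forall x, Rabs (p x) <= Cmod x) -> Series (fun k => p (c k)) = p l).
{ intros p Hp Hm Hb. apply is_series_unique.
  apply (proj2 (filterlim_locally (sum_n (fun k => p (c k))) (p l))). intros eps.
  destruct (proj1 (Cis_series_eps c l) H eps (cond_pos eps)) as [N HN].
  exists N. intros n Hn. rewrite <- Csum_proj by exact Hp.
  change (Rabs (p (@sum_n C_NormedModule c n) - p l) < eps). rewrite <- Hm.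
  eapply Rle_lt_trans; [apply Hb|]. now apply HN. }
apply injective_projections.
- apply (K Re); [reflexivity|reflexivity|exact re_le_Cmod].
- apply (K Im); [reflexivity|reflexivity|].
  intros x. eapply Rle_trans; [|apply Rmax_Cmod]. apply Rmax_r.
Qed.

Lemma Cser_ext (c d : nat -> C) : (forall n, c n = d n) -> Cser c = Cser d.
Proof. intros H. unfold Cser. f_equal; apply Series_ext; intros n; now rewrite H. Qed.

Lemma Cser_correct (c : nat -> C) (b : nat -> R) :
  (forall n, Cmod (c n) <= b n) -> ex_series b -> Cis_series c (Cser c).
Proof.
intros H Hb.
destruct (ex_series_le (K:=C_AbsRing) (V := C_CompleteNormedModule) c b H Hb) as [l Hl].
assert (Hl' : Cis_series c l) by exact Hl.
now rewrite (Cser_unique c l Hl').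
Qed.

Lemma Csum_le (c : nat -> C) (b : nat -> R) n :
  (forall n, Cmod (c n) <= b n) -> Cmod (@sum_n C_NormedModule c n) <= sum_n b n.
Proof.
intros H. induction n as [|n IH].
- rewrite !sum_O. apply H.
- rewrite !sum_Sn. eapply Rle_trans; [apply Cmod_triangle|]. now apply Rplus_le_compat.
Qed.

Lemma Cis_series_le (c : nat -> C) (b : nat -> R) l s :
  (forall n, Cmod (c n) <= b n) -> Cis_series c l -> is_series b s -> Cmod l <= s.
Proof.
intros H Hl Hs. apply le_epsilon. intros eps He.
destruct (proj1 (Cis_series_eps c l) Hl (eps/2)) as [N HN]; [lra|].
destruct (proj1 (filterlim_locally (sum_n b) s) Hs (mkposreal (eps/2) ltac:(lra))) as [M HM].
specialize (HN (N+M)%nat ltac:(lia)). specialize (HM (N+M)%nat ltac:(lia)).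
change (Rabs (sum_n b (N+M) - s) < eps/2) in HM.
apply Rabs_def2 in HM. pose proof (Csum_le c b (N+M) H).
replace l with (- (@sum_n C_NormedModule c (N+M)%nat - l) + @sum_n C_NormedModule c
    (N+M)%nat)%C by ring.
eapply Rle_trans; [apply Cmod_triangle|]. rewrite Cmod_opp. lra.
Qed.

Lemma Cis_series_plus (c d : nat -> C) l m : Cis_series c l -> Cis_series d m ->
  Cis_series (fun n => c n + d n)%C (l + m)%C.
Proof. exact (is_series_plus (K:=C_AbsRing) (V:=C_NormedModule) c d l m). Qed.

Lemma Cis_series_scal k (c : nat -> C) l : Cis_series c l ->
  Cis_series (fun n => k * c n)%C (k * l)%C.
Proof. exact (is_series_scal (K:=C_AbsRing) (V:=C_NormedModule) k c l). Qed.

Lemma Cis_series_ext (c d : nat -> C) l : (forall n, c n = d n) -> Cis_series c l ->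
  Cis_series d l.
Proof. exact (is_series_ext (K:=C_AbsRing) (V:=C_NormedModule) c d l). Qed.

Lemma Cis_series_S (c : nat -> C) l : Cis_series (fun n => c (S n))
  (l - c O)%C <-> Cis_series c l.
Proof.
split; intros H.
- exact (is_series_decr_1 (K:=C_AbsRing) (V:=C_NormedModule) c l H).
- apply (is_series_incr_1 (K:=C_AbsRing) (V:=C_NormedModule) c).
  assert (E : @plus C_AbelianMonoid (l - c O)%C (c O) = l)
    by (change (l - c O + c O = l)%C; ring).
  unfold Cis_series in H. rewrite <- E in H. exact H.
Qed.

(** Absolute convergence at the single radius [r] dominates the series uniformly on
    [Cmod z <= r]. *)
Definition summable (a : nat -> C) (r : R) : Prop := ex_series (fun k => Cmod (a k) * r ^ k).
Definition Cps (a : nat -> C) (z : C) : C := Cser (fun k => a k * z ^ k)%C.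
Definition Cps_derive (a : nat -> C) (k : nat) : C := (INR (S k) * a (S k))%C.

Lemma Cps_term_le (a : nat -> C) r z n : Cmod z <= r ->
  Cmod (a n * z ^ n)%C <= Cmod (a n) * r ^ n.
Proof.
intros H. rewrite Cmod_mult, Cmod_pow. apply Rmult_le_compat_l; [apply Cmod_ge_0|].
apply pow_incr. split; [apply Cmod_ge_0|easy].
Qed.

Lemma Cps_correct (a : nat -> C) r z : summable a r -> Cmod z <= r ->
  Cis_series (fun k => a k * z ^ k)%C (Cps a z).
Proof. intros Ha Hz. apply Cser_correct with (2 := Ha). intros n. now apply Cps_term_le. Qed.

(** Abel's lemma: comparison with a geometric series of ratio [r / r']. *)
Lemma summable_of_bounded (a : nat -> C) M r r' : 0 <= r < r' ->
  (forall k, Cmod (a k) * r' ^ k <= M) -> summable a r.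
Proof.
intros Hr HM. unfold summable.
apply (ex_series_le (K:=R_AbsRing) (V:=R_CompleteNormedModule)) with (b := fun k => M * (r / r') ^ k).
- intros k. change (Rabs (Cmod (a k) * r ^ k) <= M * (r/r')^k).
  rewrite Rabs_pos_eq by (apply Rmult_le_pos; [apply Cmod_ge_0|apply pow_le; lra]).
  replace (r ^ k) with (r' ^ k * (r / r') ^ k)
    by (rewrite <- Rpow_mult_distr; f_equal; field; lra).
  rewrite <- Rmult_assoc. apply Rmult_le_compat_r; [|apply HM].
  apply pow_le, Rdiv_le_0_compat; lra.
- apply (ex_series_scal_l (K:=R_AbsRing) (V:=R_NormedModule)), ex_series_geom.
  rewrite Rabs_pos_eq by (apply Rdiv_le_0_compat; lra).
  apply Rlt_div_l; lra.
Qed.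

Lemma lim_0_bounded (u : nat -> R) : is_lim_seq u 0 -> exists M, forall n, Rabs (u n) <= M.
Proof.
intros H. apply is_lim_seq_Reals in H.
destruct (maj_by_pos u (exist _ 0 H)) as [M [_ HM]]. now exists M.
Qed.

Lemma summable_bounded (a : nat -> C) r : 0 <= r -> summable a r ->
  exists M, forall k, Cmod (a k) * r ^ k <= M.
Proof.
intros Hr H. apply ex_series_lim_0 in H. destruct (lim_0_bounded _ H) as [M HM].
exists M. intros k. eapply Rle_trans; [apply Rle_abs|apply HM].
Qed.

(** Convergence at one real point [r'] strictly between [r] and [rho] suffices. Two consecutive
    partial sums within 1 of the limit differ by less than 2, which bounds the later terms; Abel's
    lemma concludes. *)
Lemma summable_of_conv (a : nat -> C) rho r :
  (forall z, Cmod z < rho -> exists l, Cis_series (fun k => a k * z ^ k)%C l) ->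
  0 <= r < rho -> summable a r.
Proof.
intros H Hr. set (r' := (r + rho) / 2).
assert (Hr' : 0 <= r') by (unfold r'; lra).
destruct (H (RtoC r')) as [l Hl].
{ rewrite Cmod_R, Rabs_pos_eq; unfold r'; lra. }
destruct (proj1 (Cis_series_eps _ l) Hl 1 Rlt_0_1) as [N HN].
set (u := fun k => Cmod (a k) * r' ^ k).
assert (B : forall k, (N < k)%nat -> u k <= 2).
{ intros [|k] Hk; [lia|].
  pose proof (HN k ltac:(lia)) as H1. pose proof (HN (S k) ltac:(lia)) as H2.
  rewrite sum_Sn in H2.
  set (s := @sum_n C_NormedModule _ _) in *.
  change (Cmod (s + a (S k) * RtoC r' ^ S k - l)%C < 1) in H2.
  assert (E : u (S k) = Cmod (a (S k) * RtoC r' ^ S k)%C).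
  { unfold u. rewrite Cmod_mult, Cmod_pow, Cmod_R, (Rabs_pos_eq r'); easy. }
  rewrite E. replace (a (S k) * RtoC r' ^ S k)%C with ((s + a (S k) * RtoC r' ^ S k - l) + -
      (s - l))%C by ring.
  eapply Rle_trans; [apply Cmod_triangle|]. rewrite Cmod_opp. lra. }
apply (summable_of_bounded a (2 + sum_n u N) r r'); [unfold r'; lra|].
assert (U : forall k, 0 <= u k)
  by (intros k; apply Rmult_le_pos; [apply Cmod_ge_0|now apply pow_le]).
assert (P : forall n, 0 <= sum_n u n /\ forall k, (k <= n)%nat -> u k <= sum_n u n).
{ induction n as [|n [I1 I2]].
  - rewrite sum_O. split; [apply U|]. intros k Hk. replace k with O by lia. lra.
  - rewrite sum_Sn. change (plus (sum_n u n) (u (S n))) with (sum_n u n + u (S n)).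
    pose proof (U (S n)). split; [lra|]. intros k Hk.
    destruct (Nat.eq_dec k (S n)) as [->|Hn]; [lra|]. specialize (I2 k ltac:(lia)). lra. }
intros k. change (u k <= 2 + sum_n u N). destruct (P N) as [P1 P2].
destruct (le_lt_dec k N) as [Hk|Hk]; [specialize (P2 k Hk)|specialize (B k Hk)]; lra.
Qed.

Lemma summable_le a r r' : 0 <= r <= r' -> summable a r' -> summable a r.
Proof.
intros H Ha.
apply (ex_series_le (K:=R_AbsRing) (V:=R_CompleteNormedModule)) with (2 := Ha).
intros k. change (Rabs (Cmod (a k) * r ^ k) <= Cmod (a k) * r' ^ k).
rewrite Rabs_pos_eq by (apply Rmult_le_pos; [apply Cmod_ge_0|apply pow_le; lra]).
apply Rmult_le_compat_l; [apply Cmod_ge_0|]. apply pow_incr; lra.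
Qed.

(** The moduli form a real power series, whose radius of convergence is unchanged by
    differentiation. *)
Lemma summable_derive a r r' : 0 <= r < r' -> summable a r' -> summable (Cps_derive a) r.
Proof.
intros Hr Ha. destruct (summable_bounded a r' ltac:(lra) Ha) as [M HM].
set (b := fun k => Cmod (a k)).
assert (Rb : Rbar_le r' (CV_radius b)).
{ destruct (CV_radius_bounded b) as [B _]. apply B. exists M. intros n.
  rewrite Rabs_pos_eq; [apply HM|]. apply Rmult_le_pos; [apply Cmod_ge_0|apply pow_le; lra]. }
assert (L : Rbar_lt (Rabs r) (CV_radius (PS_derive b))).
{ rewrite CV_radius_derive, Rabs_pos_eq by lra. apply Rbar_lt_le_trans with (2 := Rb).
  simpl; lra. }
apply CV_disk_inside in L.
apply ex_series_ext with (2 := L). intros k.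
unfold PS_derive, b, Cps_derive. rewrite Cmod_mult, Cmod_R.
pose proof (pos_INR (S k)). pose proof (Cmod_ge_0 (a (S k))).
rewrite (Rabs_pos_eq (INR (S k))) by easy.
apply Rabs_pos_eq. apply Rmult_le_pos; [now apply Rmult_le_pos|apply pow_le; lra].
Qed.

(** The remainder for the next exponent is [w] times the present one plus [(w - z)^2] times the
    derivative of the present power at [z]. The constant is the coefficient produced by
    differentiating twice, so summing over [k] gives the series of second derivatives. *)
Lemma Cpow_taylor k (z w : C) r : 0 <= r -> Cmod z <= r -> Cmod w <= r ->
  Cmod (w ^ (S (S k)) - z ^ (S (S k)) - (w - z) * (INR (S (S k)) * z ^ (S k)))%C
   <= INR (S k) * INR (S (S k)) * r ^ k * Cmod (w - z) ^ 2.
Proof.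
intros Hr Hz Hw.
assert (P : forall k, 0 <= r ^ k) by (intros; now apply pow_le).
assert (D := Cmod_ge_0 (w - z)%C).
induction k as [|k IH].
- replace (w ^ 2 - z ^ 2 - (w - z) * (INR 2 * z ^ 1))%C with ((w - z) ^ 2)%C.
  + rewrite Cmod_pow. simpl. nra.
  + replace (INR 2) with 2 by (simpl; lra). simpl.
    ring.
- replace (w ^ S (S (S k)) - z ^ S (S (S k)) - (w - z) * (INR (S (S (S k))) * z ^ S (S k)))%C
  with (w * (w ^ S (S k) - z ^ S (S k) - (w - z) * (INR (S (S k)) * z ^ S k))
        + (w - z) ^ 2 * (INR (S (S k)) * z ^ S k))%C.
  2: { rewrite (S_INR (S (S k))), RtoC_plus. simpl. ring. }
  eapply Rle_trans; [apply Cmod_triangle|]. rewrite !Cmod_mult, !Cmod_pow, Cmod_R.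
  rewrite (Rabs_pos_eq (INR _)) by apply pos_INR.
  assert (Z : Cmod z ^ S k <= r ^ S k) by (apply pow_incr; split; [apply Cmod_ge_0|easy]).
  set (A := Cmod (_ - _ - _)%C) in *. set (d := Cmod (w - z)) in *.
  assert (0 <= A) by apply Cmod_ge_0.
  assert (Q : Cmod w * A <= r * (INR (S k) * INR (S (S k)) * r ^ k * d ^ 2)).
  { apply Rmult_le_compat; try easy; apply Cmod_ge_0. }
  assert (D2 : 0 <= d ^ 2) by now apply pow_le.
  pose proof (pos_INR (S (S k))).
  assert (Q2 : d ^ 2 * (INR (S (S k)) * Cmod z ^ S k) <= d ^ 2 * (INR (S (S k)) * r ^ S k)).
  { apply Rmult_le_compat_l; [easy|]. apply Rmult_le_compat_l; easy. }
  eapply Rle_trans; [apply Rplus_le_compat; [apply Q|apply Q2]|].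
  rewrite (S_INR (S (S k))), (S_INR (S k)).
  pose proof (pos_INR (S k)). simpl (r ^ S k). pose proof (P k).
  assert (0 <= r * r ^ k * d ^ 2) by (apply Rmult_le_pos; [now apply Rmult_le_pos|easy]).
  rewrite (S_INR (S k)) in *.
  set (X := INR (S k)) in *. nra.
Qed.

Lemma Cps_Cder (a : nat -> C) r z : summable a r -> Cmod z < r ->
  Cder (Cps a) z (Cps (Cps_derive a) z).
Proof.
intros Ha Hz. pose proof (Cmod_ge_0 z) as Hz0.
(* Each differentiation costs some radius, and two are needed: hence [Cmod z < r1 < r2 < r]. *)
set (r1 := (Cmod z + r) / 2). set (r2 := (r1 + r) / 2).
assert (S1 : summable (Cps_derive a) r2)
  by (apply (summable_derive a r2 r); unfold r2, r1; [lra|easy]).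
assert (S2 : summable (Cps_derive (Cps_derive a)) r1)
  by (apply (summable_derive _ r1 r2); unfold r2, r1; [lra|easy]).
destruct S2 as [K HK].
assert (K0 : 0 <= K).
{ rewrite <- Cmod_0.
  refine (Cis_series_le (fun _ => RtoC 0) (fun k => Cmod (Cps_derive (Cps_derive a) k) * r1 ^
      k) _ _ _ _ HK).
  - intros n. rewrite Cmod_0.
    apply Rmult_le_pos; [apply Cmod_ge_0|apply pow_le; unfold r1; lra].
  - apply Cis_series_eps. intros eps He. exists O. intros n _.
    replace (@sum_n C_NormedModule (fun _ : nat => RtoC 0) n) with (RtoC 0).
    + replace (0 - 0)%C with (RtoC 0) by ring. now rewrite Cmod_0.
    + induction n as [|n IH]; [now rewrite sum_O|]. rewrite sum_Sn, <- IH.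
      change (RtoC 0 = 0 + 0)%C. ring. }
apply Cder_eps. intros eps He.
assert (B : forall w, Cmod w <= r1 ->
  Cmod (Cps a w - Cps a z - (w - z) * Cps (Cps_derive a) z) <= K * Cmod (w - z) ^ 2).
{ intros w Hw.
  set (D := Cps (Cps_derive a) z).
  assert (Tw : Cis_series (fun k => a k * w ^ k)%C (Cps a w))
    by (apply (Cps_correct a r); [easy|unfold r1 in Hw; lra]).
  assert (Tz : Cis_series (fun k => a k * z ^ k)%C (Cps a z))
    by (apply (Cps_correct a r); [easy|lra]).
  assert (Td : Cis_series (fun k => Cps_derive a k * z ^ k)%C D)
    by (apply (Cps_correct _ r2); [easy|unfold r2, r1; lra]).
  assert (T : Cis_series (fun k => a (S (S k)) * (w ^ (S (S k)) - z ^ (S (S k)) - (w - z) *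
      (INR (S (S k)) * z ^ (S k))))%C
     (Cps a w - Cps a z - (w - z) * D)%C).
  {
    (* The terms of degree 0 and 1 cancel in the remainder, so two terms are dropped from the series
       of values and one from the series of the derivative. *)
    assert (Tw2 := proj2 (Cis_series_S _ _) (proj2 (Cis_series_S _ _) Tw)).
    assert (Tz2 := proj2 (Cis_series_S _ _) (proj2 (Cis_series_S _ _) Tz)).
    assert (Td2 := proj2 (Cis_series_S _ _) Td).
    assert (Q := Cis_series_plus _ _ _ _ Tw2 (Cis_series_plus _ _ _ _ (Cis_series_scal (-
        (1))%C _ _ Tz2) (Cis_series_scal (- (w - z))%C _ _ Td2))).
    match type of Q with Cis_series _ ?l => replace (Cps a w - Cps a z - (w - z) * D)%C with l end.
    - apply Cis_series_ext with (2 := Q). intros n. unfold Cps_derive. ring.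
    - unfold Cps_derive. simpl. ring. }
  refine (Cis_series_le _ _ _ _ _ T (is_series_scal_r (Cmod (w - z) ^ 2) _ _ HK)).
  intros n. rewrite Cmod_mult.
  eapply Rle_trans.
  { apply Rmult_le_compat_l; [apply Cmod_ge_0|].
    apply Cpow_taylor with (r := r1); [unfold r1; lra|unfold r1; lra|exact Hw]. }
  unfold Cps_derive. rewrite !Cmod_mult, !Cmod_R, !(Rabs_pos_eq (INR _)) by apply pos_INR.
  apply Req_le. ring. }
(* The first bound keeps [w] in the disk of radius [r1], where [B] applies; the second makes
   [K * Cmod (w - z)] at most [eps]. *)
exists (Rmin (r1 - Cmod z) (eps / (K + 1))). split.
- apply Rmin_pos; [unfold r1; lra|]. apply Rdiv_lt_0_compat; lra.
- intros w Hw.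
  assert (Hw1 := Rlt_le_trans _ _ _ Hw (Rmin_l _ _)).
  assert (Hw2 := Rlt_le_trans _ _ _ Hw (Rmin_r _ _)).
  eapply Rle_trans; [apply B|].
  + replace w with ((w - z) + z)%C by ring. eapply Rle_trans; [apply Cmod_triangle|lra].
  + pose proof (Cmod_ge_0 (w - z)). apply Rlt_div_r in Hw2; [|lra].
    simpl. rewrite Rmult_1_r, <- Rmult_assoc. apply Rmult_le_compat_r; [easy|]. nra.
Qed.

(** * The exponential function *)

Lemma Cexp_plus x y : Cexp (x + y) = (Cexp x * Cexp y)%C.
Proof.
unfold Cexp. destruct x as [a b], y as [c d]. unfold Re, Im, Cplus, Cmult; simpl.
rewrite exp_plus, cos_plus, sin_plus. f_equal; ring.
Qed.

Lemma Cexp_0 : Cexp (RtoC 0) = RtoC 1.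
Proof. unfold Cexp, RtoC; simpl. rewrite exp_0, cos_0, sin_0. f_equal; ring. Qed.

Lemma Cexp_opp_r z : (Cexp z * Cexp (- z))%C = RtoC 1.
Proof. rewrite <- Cexp_plus, <- Cexp_0. f_equal. ring. Qed.

Lemma Cexp_nz z : Cexp z <> RtoC 0.
Proof. intros H. pose proof (Cexp_opp_r z) as E. rewrite H, Cmult_0_l in E. injection E. lra.
Qed.

Lemma Cexp_opp z : Cexp (- z) = (/ Cexp z)%C.
Proof.
pose proof (Cexp_nz z). rewrite <- (Cmult_1_l (/ Cexp z)), <- (Cexp_opp_r z). field. easy.
Qed.

Lemma Cmod_Cexp z : Cmod (Cexp z) = exp (Re z).
Proof.
unfold Cmod, Cexp. simpl fst; simpl snd.
replace (_ + _) with (exp (Re z) ^ 2 * (Rsqr (sin (Im z)) + Rsqr (cos (Im z))))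
  by (unfold Rsqr; ring).
rewrite sin2_cos2, Rmult_1_r, sqrt_pow2; [easy|]. apply Rlt_le, exp_pos.
Qed.

Definition exp_coeff (k : nat) : C := RtoC (/ INR (fact k)).

Lemma exp_coeff_summable r : 0 <= r -> summable exp_coeff r.
Proof.
intros Hr. exists (exp r). generalize (is_exp_Reals r).
apply is_series_ext. intros n. unfold exp_coeff. rewrite Cmod_R, Rabs_pos_eq, pow_n_pow.
- apply Rmult_comm.
- apply Rlt_le, Rinv_0_lt_compat, INR_fact_lt_0.
Qed.

Lemma Cps_derive_exp k : Cps_derive exp_coeff k = exp_coeff k.
Proof.
unfold Cps_derive, exp_coeff. rewrite <- RtoC_mult. f_equal.
rewrite fact_simpl, mult_INR. field. split; [apply INR_fact_neq_0|].
apply not_0_INR. lia.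
Qed.

Lemma Cps_0 a : Cps a (RtoC 0) = a O.
Proof.
apply Cser_unique. refine (proj1 (Cis_series_S (fun k => a k * 0 ^ k)%C _) _).

replace (a O - a O * 0 ^ 0)%C with (RtoC 0) by (simpl; ring).
apply Cis_series_ext with (fun _ => 0 * 0)%C; [intros n; simpl; ring|].
apply Cis_series_eps. intros eps He. exists O. intros n _.
replace (@sum_n C_NormedModule (fun _ => 0 * 0)%C n) with (RtoC 0).
- replace (0 - 0)%C with (RtoC 0) by ring. now rewrite Cmod_0.
- induction n as [|n IH]; [rewrite sum_O; ring|]. rewrite sum_Sn, <- IH.
  change (RtoC 0 = 0 + 0 * 0)%C. ring.
Qed.

Lemma Cps_ext a b z : (forall k, a k = b k) -> Cps a z = Cps b z.
Proof. intros H. apply Cser_ext. intros n. now rewrite H. Qed.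

(* The derivative of [Cexp] is deduced from this identity, so [F' = F] is integrated
   by real differentiation along the ray [t z]. *)
Lemma Cps_exp z : Cps exp_coeff z = Cexp z.
Proof.
set (F := Cps exp_coeff).
assert (D : forall w, Cder F w (F w)).
{ intros w. pose proof (Cmod_ge_0 w).
  unfold F at 2. rewrite <- (Cps_ext (Cps_derive exp_coeff)) by apply Cps_derive_exp.
  apply Cps_Cder with (Cmod w + 1); [apply exp_coeff_summable|]; lra. }
set (x := Re z). set (y := Im z).
set (A := fun t : R => Re (F (RtoC t * z)%C)). set (B := fun t : R => Im (F (RtoC t * z)%C)).
assert (DA : forall t, is_derive A t (x * A t - y * B t))
  by (intros t; exact (proj1 (Cder_ray F z t _ (D _)))).
assert (DB : forall t, is_derive B t (x * B t + y * A t))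
  by (intros t; exact (proj2 (Cder_ray F z t _ (D _)))).
assert (EA : forall t, ex_derive A t) by (intros t; eexists; apply DA).
assert (EB : forall t, ex_derive B t) by (intros t; eexists; apply DB).
assert (UA : forall t, Derive (fun t => A t) t = x * A t - y * B t)
  by (intros; now apply is_derive_unique).
assert (UB : forall t, Derive (fun t => B t) t = x * B t + y * A t)
  by (intros; now apply is_derive_unique).
(* The functions in [P] and [Q] are the real and imaginary parts of [F (t z) * Cexp (- t z)]. Both
   have derivative 0, so the product keeps at [t = 1] its value 1 from [t = 0]. *)
assert (P := fun H => eq_is_derive (fun t => exp (- t * x) * (A t * cos (t * y) + B t * sin
    (t * y))) 0 1 H Rlt_0_1).
assert (Q := fun H => eq_is_derive (fun t => exp (- t * x) * (B t * cos (t * y) - A t * sin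
    (t * y))) 0 1 H Rlt_0_1).
assert (F0 : F (RtoC 0 * z)%C = RtoC 1).
{ rewrite Cmult_0_l. unfold F. rewrite Cps_0. unfold exp_coeff. simpl. now rewrite Rinv_1. }
assert (A1 : A 0 = 1) by (unfold A; now rewrite F0).
assert (B1 : B 0 = 0) by (unfold B; now rewrite F0).
assert (E1 : A 1 = Re (F z)) by (unfold A; now rewrite Cmult_1_l).
assert (E2 : B 1 = Im (F z)) by (unfold B; now rewrite Cmult_1_l).
cbv beta in P, Q. rewrite A1, B1, E1, E2 in P, Q.
replace (- 0 * x) with 0 in P, Q by ring.
rewrite (Rmult_0_l y), exp_0, cos_0, sin_0, !(Rmult_1_l y) in P, Q.
assert (HP := P ltac:(intros t Ht; auto_derive; [now split|rewrite UA, UB; change (@zero _)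
    with 0; ring])).
assert (HQ := Q ltac:(intros t Ht; auto_derive; [now split|rewrite UA, UB; change (@zero _)
    with 0; ring])).
clearbody F. assert (M : (F z * Cexp (- z))%C = RtoC 1).
{ unfold Cexp. replace (Re (- z)%C) with (- (1) * x) by (unfold x, Re; simpl; ring).
  replace (Im (- z)%C) with (- y) by reflexivity. rewrite cos_neg, sin_neg.
  apply injective_projections; simpl; unfold Re, Im in *.
  - match type of HP with ?a = ?b => assert (HP' : @eq R a b) by exact HP end. lra.
  - match type of HQ with ?a = ?b => assert (HQ' : @eq R a b) by exact HQ end. lra. }
rewrite <- (Cmult_1_r (F z)), <- (Cexp_opp_r z), (Cmult_comm (Cexp z)), Cmult_assoc, M. ring.
Qed.

Lemma Cexp_Cder z : Cder Cexp z (Cexp z).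
Proof.
pose proof (Cmod_ge_0 z).
apply (Cder_ext_disk (Cps exp_coeff) Cexp (Cmod z + 1)); [intros; apply Cps_exp|lra|].
rewrite <- (Cps_exp z). rewrite <- (Cps_ext (Cps_derive exp_coeff)) by apply Cps_derive_exp.
apply Cps_Cder with (Cmod z + 1); [apply exp_coeff_summable|]; lra.
Qed.

Lemma Cexp_comp_Cder f z l : Cder f z l -> Cder (fun w => Cexp (f w)) z (l * Cexp (f z))%C.
Proof. intros H. exact (Cder_comp Cexp f z _ _ (Cexp_Cder _) H). Qed.

Lemma Cps_uniform a r : 0 <= r -> summable a r -> forall eps, 0 < eps ->
  exists N, forall n, (N <= n)%nat ->
  forall z, Cmod z <= r ->
    Cmod (Cps a z - @sum_n C_NormedModule (fun k => a k * z ^ k)%C n) <= eps.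
Proof.
intros Hr [s Hs] eps He.
destruct (proj1 (filterlim_locally (sum_n (fun k => Cmod (a k) * r ^ k)) s) Hs (mkposreal eps
    He)) as [N HN].
exists N. intros n Hn z Hz. specialize (HN n Hn).
change (Rabs (sum_n (fun k => Cmod (a k) * r ^ k) n - s) < eps) in HN. apply Rabs_def2 in HN.
apply Rle_trans with (s - sum_n (fun k => Cmod (a k) * r ^ k) n); [|lra].
refine (Cis_series_le (fun k => a (S n + k)%nat * z ^ (S n + k))%C (fun k => Cmod (a (S n +
    k)%nat) * r ^ (S n + k)) _ _ _ _ _).
- intros k. now apply Cps_term_le.
- apply (is_series_incr_n (K:=C_AbsRing) (V:=C_NormedModule) (fun k => a k * z ^ k)%C (S n));
    [lia|].
  assert (T := Cps_correct a r z (ex_intro _ s Hs) Hz).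
  set (S1 := @sum_n C_NormedModule (fun k : nat => (a k * z ^ k)%C) n).
  change (@sum_n _ (fun k : nat => (a k * z ^ k)%C) (Init.Nat.pred (S n))) with S1.
  assert (E : @plus C_AbelianMonoid (Cps a z - S1)%C S1 = Cps a z)
    by (change (Cps a z - S1 + S1 = Cps a z)%C; ring).
  unfold Cis_series in T. rewrite <- E in T. exact T.
- apply (is_series_incr_n (fun k => Cmod (a k) * r ^ k) (S n)); [lia|]. simpl pred.
  set (S1 := sum_n _ n).
  assert (E : plus (s - S1) S1 = s) by (change (s - S1 + S1 = s); ring).
  rewrite <- E in Hs. exact Hs.
Qed.

(** * Polynomials and means over roots of unity *)

Definition peval (l : list C) (z : C) : C := fold_right (fun c s => c + z * s)%C (RtoC 0) l.
Definition ispoly (F : C -> C) : Prop := exists l, forall z, F z = peval l z.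

Lemma ispoly_ext F G : (forall z, F z = G z) -> ispoly F -> ispoly G.
Proof. intros E [l H]. exists l. intros z. now rewrite <- E. Qed.

Lemma ispoly_const c : ispoly (fun _ => c).
Proof. exists (c :: nil). intros z. simpl. ring. Qed.

Lemma ispoly_id : ispoly (fun z => z).
Proof. exists (RtoC 0 :: RtoC 1 :: nil). intros z. simpl. ring. Qed.

Lemma ispoly_plus F G : ispoly F -> ispoly G -> ispoly (fun z => F z + G z)%C.
Proof.
intros [l Hl] [m Hm].
apply ispoly_ext with (fun z => peval l z + peval m z)%C; [intros; now rewrite Hl, Hm|].
clear F G Hl Hm. revert m. induction l as [|c l IH]; intros m.
- exists m. intros z. simpl. ring.
- destruct m as [|d m].
  + exists (c :: l). intros z. simpl. ring.
  + destruct (IH m) as [k Hk]. exists ((c + d)%C :: k). intros z. simpl. rewrite <- Hk. ring.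
Qed.

Lemma ispoly_cons c F : ispoly F -> ispoly (fun z => c + z * F z)%C.
Proof. intros [l H]. exists (c :: l). intros z. simpl. now rewrite H. Qed.

Lemma ispoly_scal c F : ispoly F -> ispoly (fun z => c * F z)%C.
Proof.
intros [l H]. exists (map (Cmult c) l). intros z. rewrite H. clear H.
induction l as [|d l IH]; simpl; [ring|]. rewrite <- IH. ring.
Qed.

Lemma ispoly_mult F G : ispoly F -> ispoly G -> ispoly (fun z => F z * G z)%C.
Proof.
intros [l Hl] HG.
apply ispoly_ext with (fun z => peval l z * G z)%C; [intros; now rewrite Hl|].
clear F Hl. induction l as [|c l IH].
- apply ispoly_ext with (2 := ispoly_const (RtoC 0)). intros z. simpl. ring.
- apply ispoly_ext with (2 := ispoly_plus _ _ (ispoly_scal c G HG) (ispoly_cons (RtoC 0) _ IH)).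
  intros z. simpl. ring.
Qed.

Lemma ispoly_pow F n : ispoly F -> ispoly (fun z => F z ^ n)%C.
Proof.
intros H. induction n as [|n IH].
- exact (ispoly_const (RtoC 1)).
- exact (ispoly_mult _ _ H IH).
Qed.

Lemma ispoly_scale (r : C) F : ispoly F -> ispoly (fun z => F (r * z))%C.
Proof.
intros [l H]. apply ispoly_ext with (fun z => peval l (r * z))%C; [intros; now rewrite H|].
clear H F. induction l as [|c l IH].
- exact (ispoly_const (RtoC 0)).
- apply ispoly_ext with (2 := ispoly_cons c _ (ispoly_scal r _ IH)). intros z. simpl. ring.
Qed.

Lemma ispoly_bounded F r : 0 <= r -> ispoly F -> exists B, forall z, Cmod z <= r ->
  Cmod (F z) <= B.
Proof.
intros Hr [l H]. revert F H. induction l as [|c l IH]; intros F H.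
- exists 0. intros z _. rewrite H. simpl. rewrite Cmod_0. lra.
- destruct (IH (peval l) (fun z => eq_refl)) as [B HB].
  exists (Cmod c + r * B). intros z Hz. rewrite H. simpl.
  eapply Rle_trans; [apply Cmod_triangle|]. apply Rplus_le_compat_l. rewrite Cmod_mult.
  apply Rmult_le_compat; try apply Cmod_ge_0; auto.
Qed.

Lemma Cexp_pow z n : (Cexp z ^ n)%C = Cexp (INR n * z)%C.
Proof.
induction n as [|n IH].
- simpl. now rewrite Cmult_0_l, Cexp_0.
- rewrite S_INR, RtoC_plus. replace ((INR n + 1) * z)%C with (z + INR n * z)%C by ring.
  now rewrite Cexp_plus, <- IH.
Qed.

Lemma Csum_Sn (f : nat -> C) n :
  @sum_n C_NormedModule f (S n) = (@sum_n C_NormedModule f n + f (S n))%C.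
Proof. exact (@sum_Sn C_NormedModule f n). Qed.

Lemma Csum_O (f : nat -> C) : @sum_n C_NormedModule f 0 = f 0%nat.
Proof. exact (@sum_O C_NormedModule f). Qed.

Lemma geom_sum (q : C) n :
  ((q - 1) * @sum_n C_NormedModule (fun j => q ^ j)%C n)%C = (q ^ S n - 1)%C.
Proof.
induction n as [|n IH].
- rewrite sum_O. simpl. ring.
- rewrite sum_Sn. change (plus ?a ?b) with (Cplus a b). rewrite Cmult_plus_distr_l, IH. simpl.
  ring.
Qed.

Lemma Cexp_imag k t : Cexp (RtoC k * (0, t)%R)%C = (cos (k * t), sin (k * t)).
Proof.
unfold Cexp, Re, Im, Cmult, RtoC, fst, snd.
replace (k * 0 - 0 * t) with 0 by ring. replace (k * t + 0 * 0) with (k * t) by ring.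
now rewrite exp_0, !Rmult_1_l.
Qed.

(** The order is [S N], so that [sum_n] up to [N] runs over each root exactly once. *)
Definition root_of_unity (N : nat) (j : nat) : C := (Cexp (0, 2 * PI / INR (S N))%R ^ j)%C.

Lemma root_of_unity_mod N j : Cmod (root_of_unity N j) = 1.
Proof. unfold root_of_unity. rewrite Cmod_pow, Cmod_Cexp. simpl. rewrite exp_0. apply pow1. Qed.

Lemma root_of_unity_sum N m : (0 < m <= N)%nat ->
  @sum_n C_NormedModule (fun j => root_of_unity N j ^ m)%C N = RtoC 0.
Proof.
intros Hm. set (q := (Cexp (0, 2 * PI / INR (S N))%R ^ m)%C).
assert (HN : 0 < INR (S N)) by (apply lt_0_INR; lia).
assert (Hq1 : (q ^ S N)%C = RtoC 1).
{ unfold q. rewrite <- Cpow_mult_r, Nat.mul_comm, Cpow_mult_r.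
  replace (Cexp (0, 2 * PI / INR (S N))%R ^ S N)%C with (RtoC 1); [apply Cpow_1_l|].
  rewrite Cexp_pow, Cexp_imag.
  replace (INR (S N) * _) with (2 * PI) by (field; lra).
  now rewrite cos_2PI, sin_2PI. }
(* The real part of [q] is [1 - 2 sin(t)^2] with [t = PI * m / (N + 1)]. Since [0 < m <= N], [t]
   lies strictly between 0 and [PI], where the sine is positive. *)
assert (Hq : q <> RtoC 1).
{ unfold q. rewrite Cexp_pow, Cexp_imag. set (x := INR (S N)) in *. intros E.
  apply (f_equal fst) in E.
  unfold RtoC, fst in E. set (t := PI * INR m / x).
  replace (INR m * _) with (2 * t) in E by (unfold t; field; lra).
  rewrite cos_2a_sin in E.
  assert (0 < INR m) by (apply lt_0_INR; lia).
  assert (INR m < x) by (apply lt_INR; lia).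
  assert (0 < sin t).
  { pose proof PI_RGT_0. apply sin_gt_0; unfold t.
    - apply Rdiv_lt_0_compat; nra.
    - apply Rlt_div_l; nra. }
  nra. }
rewrite (sum_n_ext _ (fun j => q ^ j)%C).
- pose proof (geom_sum q N) as G. rewrite Hq1 in G.
  replace (1 - 1)%C with (RtoC 0) in G by ring.
  apply (f_equal (Cmult (/ (q - 1)))) in G.
  rewrite Cmult_0_r, Cmult_assoc, Cinv_l, Cmult_1_l in G.
  + exact G.
  + intros E. apply Hq. replace q with ((q - 1) + 1)%C by ring. rewrite E. ring.
- intros j. unfold root_of_unity, q. now rewrite <- !Cpow_mult_r, Nat.mul_comm.
Qed.

Lemma Csum_plus (f g : nat -> C) n :
  @sum_n C_NormedModule (fun j => f j + g j)%C n = (@sum_n C_NormedModule f n + @sum_n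
      C_NormedModule g n)%C.
Proof. exact (sum_n_plus f g n). Qed.

Lemma Csum_scal c (f : nat -> C) n :
  @sum_n C_NormedModule (fun j => c * f j)%C n = (c * @sum_n C_NormedModule f n)%C.
Proof. exact (sum_n_mult_l (K := C_Ring) c f n). Qed.

Lemma Csum_ext (f g : nat -> C) n : (forall j, f j = g j) ->
  @sum_n C_NormedModule f n = @sum_n C_NormedModule g n.
Proof. intros H. now apply sum_n_ext. Qed.

Ltac cring := match goal with |- @eq _ ?a ?b => change (@eq C a b) end; ring.

Lemma root_of_unity_sum_poly N l m : (0 < m)%nat -> (m + length l <= S N)%nat ->
  @sum_n C_NormedModule (fun j => root_of_unity N j ^ m * peval l (root_of_unity N j))%C N = RtoC 0.
Proof.
revert m. induction l as [|c l IH]; intros m Hm HN.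
- rewrite (Csum_ext _ (fun j => RtoC 0 * RtoC 0)%C) by (intros; simpl; ring).
  rewrite Csum_scal. cring.
- simpl in HN.
  rewrite (Csum_ext _ (fun j => c * root_of_unity N j ^ m + root_of_unity N j ^ S m * peval l
      (root_of_unity N j)))%C by (intros; simpl; ring).
  rewrite Csum_plus, Csum_scal, root_of_unity_sum, IH by lia. cring.
Qed.

(* A polynomial without constant term averages to 0 over sufficiently many roots
   of unity. *)
Lemma circle_mean G b : ispoly G -> (forall w, Cmod w = 1 -> 0 <= b + Re (w * G w)%C) -> 0 <= b.
Proof.
intros [l Hl] H. set (N := length l).
assert (E := root_of_unity_sum_poly N l 1 ltac:(lia) ltac:(unfold N; lia)).
apply (f_equal Re) in E. rewrite (Csum_proj Re) in E by reflexivity.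
assert (S : 0 <= sum_n (fun j => b + Re (root_of_unity N j ^ 1 * peval l (root_of_unity N j))%C) N).
{ generalize N at 3. intros n. induction n as [|n IHn].
  - rewrite sum_O, Cpow_1_r, <- Hl. apply H, root_of_unity_mod.
  - rewrite sum_Sn. apply Rplus_le_le_0_compat; [exact IHn|].
    rewrite Cpow_1_r, <- Hl. apply H, root_of_unity_mod. }
rewrite (sum_n_plus (fun _ => b)) in S. rewrite sum_n_const in S.
change (plus ?x ?y) with (x + y) in S. rewrite E in S. simpl (Re _) in S.
assert (0 < INR (Datatypes.S N)) by (apply lt_0_INR; lia). nra.
Qed.

(** Peels one coefficient off a squared modulus. The cross term conjugates only the constant [e], so
    it is still [w] times a polynomial value when [F] is one, and disappears under [circle_mean]. *)
Lemma Cmod2_circle_step (w e F : C) : Cmod w = 1 ->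
  Cmod (e + w * F)%C ^ 2 = Cmod e ^ 2 + Cmod F ^ 2 + 2 * Re (w * (Cconj e * F))%C.
Proof.
intros Hw. assert (W : Cmod w ^ 2 = 1) by (rewrite Hw; ring).
rewrite Cmod2_alt in W. rewrite !Cmod2_alt. destruct w as [a b], e as [c d], F as [x y].
unfold Re, Im, Cconj, Cmult, Cplus in *; simpl fst in *; simpl snd in *.
replace (x ^ 2 + y ^ 2) with ((a ^ 2 + b ^ 2) * (x ^ 2 + y ^ 2)) at 1 by (rewrite W; ring).
ring.
Qed.

(* [F] is a polynomial function congruent to [c0 + c1 z + c2 z^2 + c3 z^3]
   modulo [z^4]. *)
Definition jet (F : C -> C) (c0 c1 c2 c3 : C) : Prop :=
  exists R, ispoly R /\ forall z, F z = (c0 + z * (c1 + z * (c2 + z * (c3 + z * R z))))%C.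

(** A pointwise form of Bessel's inequality: four peelings, after which the square of the remainder
    is discarded. *)
Lemma jet_circle F c0 c1 c2 c3 : jet F c0 c1 c2 c3 -> exists G, ispoly G /\
  forall w, Cmod w = 1 ->
    Cmod c0 ^ 2 + Cmod c1 ^ 2 + Cmod c2 ^ 2 + Cmod c3 ^ 2 + Re (w * G w)%C <= Cmod (F w) ^ 2.
Proof.
intros [R [HR HF]].
set (F3 := (fun z => c3 + z * R z)%C). assert (P3 : ispoly F3) by now apply ispoly_cons.
set (F2 := (fun z => c2 + z * F3 z)%C). assert (P2 : ispoly F2) by now apply ispoly_cons.
set (F1 := (fun z => c1 + z * F2 z)%C). assert (P1 : ispoly F1) by now apply ispoly_cons.
exists (fun z => RtoC 2 * ((Cconj c0 * F1 z + Cconj c1 * F2 z) + (Cconj c2 * F3 z + Cconj c3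
    * R z)))%C. split.
- apply ispoly_scal. repeat apply ispoly_plus; now apply ispoly_scal.
- intros w Hw. rewrite HF.
  change (c0 + w * (c1 + w * (c2 + w * (c3 + w * R w))))%C with (c0 + w * F1 w)%C.
  assert (E3 := Cmod2_circle_step w c3 (R w) Hw).
  assert (E2 := Cmod2_circle_step w c2 (F3 w) Hw).
  assert (E1 := Cmod2_circle_step w c1 (F2 w) Hw).
  assert (E0 := Cmod2_circle_step w c0 (F1 w) Hw).
  change (c3 + w * R w)%C with (F3 w) in E3. change (c2 + w * F3 w)%C with (F2 w) in E2.
  change (c1 + w * F2 w)%C with (F1 w) in E1. rewrite E0, E1, E2, E3.
  replace (w * (2 * (Cconj c0 * F1 w + Cconj c1 * F2 w + (Cconj c2 * F3 w + Cconj c3 * R w))))%C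
   with (2 * (w * (Cconj c0 * F1 w)) + 2 * (w * (Cconj c1 * F2 w)) + 2 * (w * (Cconj c2 * F3
       w)) + 2 * (w * (Cconj c3 * R w)))%C by ring.
  assert (L : forall x y : C, Re (x + y)%C = Re x + Re y) by reflexivity.
  assert (L2 : forall x : C, Re (2 * x)%C = 2 * Re x) by (intros; unfold Re; simpl; ring).
  rewrite !L, !L2. pose proof (pow2_ge_0 (Cmod (R w))). lra.
Qed.

(** * Uniform approximation by polynomials with prescribed 3-jets *)

(* Multiplication by [c1 z + c2 z^2 + c3 z^3], truncated after degree 3, has norm
   at most [M]; the coefficient [q3] would play no role. *)
Definition toeplitz_contraction (M : R) (c1 c2 c3 : C) : Prop :=
  forall q0 q1 q2 : C,
  Cmod (q0 * c1) ^ 2 + Cmod (q0 * c2 + q1 * c1) ^ 2 + Cmod (q0 * c3 + q1 * c2 + q2 * c1) ^ 2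
   <= M ^ 2 * (Cmod q0 ^ 2 + Cmod q1 ^ 2 + Cmod q2 ^ 2).

(** On the circle the square of [W Q] is at most [M^2] times that of [Q]. The left side is bounded
    below by the jet of [W Q]; the right side expands exactly because [Q] has degree 2. The cross
    terms average to 0. *)
Lemma toeplitz_poly W M c1 c2 c3 : jet W (RtoC 0) c1 c2 c3 ->
  (forall w, Cmod w = 1 -> Cmod (W w) <= M) -> toeplitz_contraction M c1 c2 c3.
Proof.
intros [R [HR HW]] HM q0 q1 q2.
set (Q := fun z => (q0 + z * (q1 + z * q2))%C).
assert (PQ1 : ispoly (fun z => q1 + z * q2)%C) by apply ispoly_cons, ispoly_const.
assert (PQ : ispoly Q) by now apply ispoly_cons.
assert (J : jet (fun z => W z * Q z)%C (RtoC 0) (q0 * c1) (q0 * c2 + q1 * c1) (q0 * c3 + q1 *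
    c2 + q2 * c1)).
{ exists (fun z => (R z * Q z + (q1 * c3 + q2 * c2 + z * (q2 * c3))))%C. split.
  - apply ispoly_plus; [now apply ispoly_mult|apply ispoly_cons, ispoly_const].
  - intros z. rewrite HW. unfold Q. ring. }
destruct (jet_circle _ _ _ _ _ J) as [G [HG HGw]].
set (G' := fun z => (RtoC 2 * (Cconj q0 * (q1 + z * q2) + Cconj q1 * q2))%C).
assert (HG' : ispoly G').
{ apply ispoly_scal, ispoly_plus; [now apply ispoly_scal|apply ispoly_const]. }
assert (K := circle_mean (fun z => RtoC (M ^ 2) * G' z + - (1) * G z)%C
  (M ^ 2 * (Cmod q0 ^ 2 + Cmod q1 ^ 2 + Cmod q2 ^ 2) - (Cmod (q0 * c1) ^ 2 + Cmod (q0 * c2 +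
      q1 * c1) ^ 2 + Cmod (q0 * c3 + q1 * c2 + q2 * c1) ^ 2))).
enough (0 <= M ^ 2 * (Cmod q0 ^ 2 + Cmod q1 ^ 2 + Cmod q2 ^ 2) - (Cmod (q0 * c1) ^ 2 + Cmod
    (q0 * c2 + q1 * c1) ^ 2 + Cmod (q0 * c3 + q1 * c2 + q2 * c1) ^ 2)) by lra.
apply K.
- apply ispoly_plus; now apply ispoly_scal.
- intros w Hw. specialize (HGw w Hw). rewrite Cmod_0 in HGw.
  assert (EQ : Cmod (Q w) ^ 2 = Cmod q0 ^ 2 + Cmod q1 ^ 2 + Cmod q2 ^ 2 + Re (w * G' w)%C).
  { unfold Q, G'. rewrite 2!Cmod2_circle_step by easy.
    replace (w * (2 * (Cconj q0 * (q1 + w * q2) + Cconj q1 * q2)))%C with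
      (2 * (w * (Cconj q0 * (q1 + w * q2))) + 2 * (w * (Cconj q1 * q2)))%C by ring.
    assert (L : forall x y : C, Re (x + y)%C = Re x + Re y) by reflexivity.
    assert (L2 : forall x : C, Re (2 * x)%C = 2 * Re x) by (intros; unfold Re; simpl; ring).
    rewrite L, !L2. ring. }
  assert (B : Cmod (W w * Q w)%C ^ 2 <= M ^ 2 * Cmod (Q w) ^ 2).
  { rewrite Cmod_mult, Rpow_mult_distr. apply Rmult_le_compat_r; [apply pow2_ge_0|].
    apply pow_incr. split; [apply Cmod_ge_0|now apply HM]. }
  rewrite EQ in B.
  replace (w * (RtoC (M ^ 2) * G' w + - (1) * G w))%C with (RtoC (M ^ 2) * (w * G' w) - w * G
      w)%C by ring.
  assert (L : Re (RtoC (M ^ 2) * (w * G' w) - w * G w)%C = M ^ 2 * Re (w * G' w)%C - Re (w * G w)%C).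
  { unfold Re, RtoC. cbn [fst snd Cminus Cplus Copp Cmult]. ring. }
  rewrite L. lra.
Qed.

Lemma jet_ispoly F c0 c1 c2 c3 : jet F c0 c1 c2 c3 -> ispoly F.
Proof.
intros [R [HR H]]. apply ispoly_ext with (1 := fun z => eq_sym (H z)).
now repeat apply ispoly_cons.
Qed.

(** * Operations on 3-jets and on their uniform approximations *)

Lemma jet_const c : jet (fun _ => c) c (RtoC 0) (RtoC 0) (RtoC 0).
Proof. exists (fun _ => RtoC 0). split; [apply ispoly_const|]. intros z. ring. Qed.

Lemma jet_plus F G c0 c1 c2 c3 d0 d1 d2 d3 : jet F c0 c1 c2 c3 -> jet G d0 d1 d2 d3 ->
  jet (fun z => F z + G z)%C (c0 + d0) (c1 + d1) (c2 + d2) (c3 + d3).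
Proof.
intros [R [HR H]] [S [HS K]]. exists (fun z => R z + S z)%C. split; [now apply ispoly_plus|].
intros z. rewrite H, K. ring.
Qed.

Lemma jet_mult F G c0 c1 c2 c3 d0 d1 d2 d3 : jet F c0 c1 c2 c3 -> jet G d0 d1 d2 d3 ->
  jet (fun z => F z * G z)%C (c0 * d0) (c0 * d1 + c1 * d0) (c0 * d2 + c1 * d1 + c2 * d0)
   (c0 * d3 + c1 * d2 + c2 * d1 + c3 * d0).
Proof.
intros HF HG. pose proof (jet_ispoly _ _ _ _ _ HG) as PG.
destruct HF as [R [HR H]], HG as [S [HS K]].
exists (fun z => R z * G z + (c0 * S z + z * (c1 * S z) + z * z * (c2 * S z) + z * z * z * (c3 * S z)
   + ((c1 * d3 + c2 * d2 + c3 * d1) + z * (c2 * d3 + c3 * d2 + z * (c3 * d3)))))%C. split.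
- assert (Z := ispoly_id).
  repeat first [apply ispoly_plus | apply ispoly_mult | apply ispoly_const | assumption].
- intros z. rewrite H, K. ring.
Qed.

Lemma jet_scale (r : C) F c0 c1 c2 c3 : jet F c0 c1 c2 c3 ->
  jet (fun z => F (r * z))%C c0 (r * c1) (r ^ 2 * c2) (r ^ 3 * c3).
Proof.
intros [R [HR H]]. exists (fun z => r ^ 4 * R (r * z))%C. split.
- now apply ispoly_scal, ispoly_scale.
- intros z. rewrite H. ring.
Qed.

(** The approximants carry the prescribed jet exactly and not merely in the limit, so coefficients
    are computed algebraically and no Cauchy estimate enters. *)
Definition approx (r : R) (F : C -> C) (c0 c1 c2 c3 : C) : Prop :=
  forall eps, 0 < eps -> exists P, jet P c0 c1 c2 c3 /\
    forall z, Cmod z <= r -> Cmod (F z - P z) <= eps.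

Lemma approx_jet r F c0 c1 c2 c3 : jet F c0 c1 c2 c3 -> approx r F c0 c1 c2 c3.
Proof.
intros H eps He. exists F. split; [easy|]. intros z _.
replace (F z - F z)%C with (RtoC 0) by ring. rewrite Cmod_0. lra.
Qed.

Lemma approx_eq r F c0 c1 c2 c3 d0 d1 d2 d3 :
  c0 = d0 -> c1 = d1 -> c2 = d2 -> c3 = d3 -> approx r F c0 c1 c2 c3 -> approx r F d0 d1 d2 d3.
Proof. now intros -> -> -> ->. Qed.

Lemma approx_bounded r F c0 c1 c2 c3 : 0 <= r -> approx r F c0 c1 c2 c3 ->
  exists B, 0 <= B /\ forall z, Cmod z <= r -> Cmod (F z) <= B.
Proof.
intros Hr H. destruct (H 1 Rlt_0_1) as [P [HP HP']].
destruct (ispoly_bounded P r Hr (jet_ispoly _ _ _ _ _ HP)) as [B HB].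
assert (K : forall z, Cmod z <= r -> Cmod (F z) <= 1 + B).
{ intros z Hz. replace (F z) with ((F z - P z) + P z)%C by ring.
  eapply Rle_trans; [apply Cmod_triangle|]. apply Rplus_le_compat; auto. }
exists (1 + B). split; [|exact K].
eapply Rle_trans; [|apply (K (RtoC 0))]; [apply Cmod_ge_0|now rewrite Cmod_0].
Qed.

Lemma approx_plus r F G c0 c1 c2 c3 d0 d1 d2 d3 : approx r F c0 c1 c2 c3 ->
  approx r G d0 d1 d2 d3 ->
  approx r (fun z => F z + G z)%C (c0 + d0) (c1 + d1) (c2 + d2) (c3 + d3).
Proof.
intros HF HG eps He.
destruct (HF (eps / 2)) as [P [HP HP']]; [lra|].
destruct (HG (eps / 2)) as [Q [HQ HQ']]; [lra|].
exists (fun z => P z + Q z)%C. split; [now apply jet_plus|]. intros z Hz.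
replace (F z + G z - (P z + Q z))%C with ((F z - P z) + (G z - Q z))%C by ring.
eapply Rle_trans; [apply Cmod_triangle|]. specialize (HP' z Hz). specialize (HQ' z Hz). lra.
Qed.

Lemma approx_mult r F G c0 c1 c2 c3 d0 d1 d2 d3 : 0 <= r -> approx r F c0 c1 c2 c3 ->
  approx r G d0 d1 d2 d3 ->
  approx r (fun z => F z * G z)%C (c0 * d0) (c0 * d1 + c1 * d0) (c0 * d2 + c1 * d1 + c2 * d0)
   (c0 * d3 + c1 * d2 + c2 * d1 + c3 * d0).
Proof.
intros Hr HF HG eps He.
destruct (approx_bounded _ _ _ _ _ _ Hr HF) as [BF [BF0 HBF]].
destruct (approx_bounded _ _ _ _ _ _ Hr HG) as [BG [BG0 HBG]].
(* [FG - PQ = F (G - Q) + (F - P) Q]. Taking [e <= 1] bounds [Q] by [BG + 1], so the error is at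
   most [e * (BF + BG + 1)]. *)
set (e := Rmin 1 (eps / (BF + BG + 1))).
assert (He' : 0 < e) by (apply Rmin_pos; [lra|apply Rdiv_lt_0_compat; lra]).
assert (E1 : e <= 1) by apply Rmin_l. assert (E2 : e * (BF + BG + 1) <= eps).
{ apply Rle_div_r; [lra|apply Rmin_r]. }
destruct (HF e He') as [P [HP HP']]. destruct (HG e He') as [Q [HQ HQ']].
exists (fun z => P z * Q z)%C. split; [now apply jet_mult|]. intros z Hz.
specialize (HP' z Hz). specialize (HQ' z Hz). specialize (HBF z Hz). specialize (HBG z Hz).
replace (F z * G z - P z * Q z)%C with (F z * (G z - Q z) + (F z - P z) * (G z + - (G z - Q
    z)))%C by ring.
eapply Rle_trans; [apply Cmod_triangle|]. rewrite !Cmod_mult.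
assert (T := Cmod_triangle (G z) (- (G z - Q z))%C). rewrite Cmod_opp in T.
assert (A1 : Cmod (F z) * Cmod (G z - Q z) <= BF * e)
  by (apply Rmult_le_compat; try apply Cmod_ge_0; easy).
assert (A2 : Cmod (F z - P z) * Cmod (G z + - (G z - Q z)) <= e * (BG + 1))
  by (apply Rmult_le_compat; try apply Cmod_ge_0; lra).
lra.
Qed.

Lemma approx_ps r a : 0 <= r -> summable a r ->
  approx r (Cps a) (a 0%nat) (a 1%nat) (a 2%nat) (a 3%nat).
Proof.
intros Hr Ha eps He. destruct (Cps_uniform a r Hr Ha eps He) as [N HN].
exists (fun z => @sum_n C_NormedModule (fun k => a k * z ^ k)%C (3 + N)). split.
- clear HN. induction N as [|N IH].
  + exists (fun _ => RtoC 0). split; [apply ispoly_const|]. intros z.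
    change (3 + 0)%nat with 3%nat. rewrite !Csum_Sn, Csum_O. simpl. cring.
  + destruct IH as [R [HR H]]. exists (fun z => R z + a (4 + N)%nat * z ^ N)%C. split.
    * apply ispoly_plus; [easy|]. apply ispoly_scal, ispoly_pow, ispoly_id.
    * intros z. rewrite Nat.add_succ_r, Csum_Sn, H. simpl. cring.
- intros z Hz. apply HN; [lia|easy].
Qed.

Lemma Cexp_lipschitz0 : exists d, 0 < d /\ forall h, Cmod h < d ->
  Cmod (Cexp h - 1) <= 2 * Cmod h.
Proof.
destruct (proj1 (Cder_eps _ _ _) (Cexp_Cder (RtoC 0)) 1 Rlt_0_1) as [d [Hd H]].
exists d. split; [easy|]. intros h Hh.
replace h with (h - 0)%C in Hh by ring. specialize (H h Hh).
rewrite Cexp_0 in H. replace (h - 0)%C with h in H by ring.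
replace (Cexp h - 1)%C with ((Cexp h - 1 - h * 1) + h)%C by ring.
eapply Rle_trans; [apply Cmod_triangle|]. lra.
Qed.

(** A partial sum of the exponential series is composed with an approximant [P] of [F]. As [P] has
    no constant term, powers from the fourth on leave the jet unchanged. *)
Lemma approx_exp r F c1 c2 c3 : 0 <= r -> approx r F (RtoC 0) c1 c2 c3 ->
  approx r (fun z => Cexp (F z)) (RtoC 1) c1 (c2 + c1 ^ 2 / 2) (c3 + c1 * c2 + c1 ^ 3 / 6).
Proof.
intros Hr HF eps He.
destruct (approx_bounded _ _ _ _ _ _ Hr HF) as [B [B0 HB]].
destruct (Cps_uniform exp_coeff (B + 1) ltac:(lra) (exp_coeff_summable (B + 1) ltac:(lra))
    (eps / 2)) as [N HN]; [lra|].
destruct Cexp_lipschitz0 as [d [Hd HL]].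
pose proof (exp_pos (B + 1)) as Hexp.
(* The three bounds serve in turn to keep [P] below [B + 1], to place [F - P] where
   [Cexp_lipschitz0] holds, and to give [exp (B + 1) * 2 e <= eps / 2]. The other half of [eps] pays
   for truncating the exponential. *)
set (e := Rmin (Rmin 1 (d / 2)) (eps / (4 * exp (B + 1)))).
assert (He' : 0 < e).
{ apply Rmin_pos; [apply Rmin_pos; lra|]. apply Rdiv_lt_0_compat; lra. }
assert (E1 : e <= 1) by (eapply Rle_trans; [apply Rmin_l|apply Rmin_l]).
assert (E2 : e <= d / 2) by (eapply Rle_trans; [apply Rmin_l|apply Rmin_r]).
assert (E3 : e * (4 * exp (B + 1)) <= eps) by (apply Rle_div_r; [lra|apply Rmin_r]).
destruct (HF e He') as [P [HP HP']].
exists (fun z => @sum_n C_NormedModule (fun k => exp_coeff k * P z ^ k)%C (3 + N)). split.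
- clear HN. induction N as [|N IH].
  + pose proof (jet_mult _ _ _ _ _ _ _ _ _ _ HP HP) as HP2.
    pose proof (jet_mult _ _ _ _ _ _ _ _ _ _ HP HP2) as HP3.
    pose proof (jet_mult _ _ _ _ _ _ _ _ _ _ (jet_const (/ 2)%C) HP2) as HP2'.
    pose proof (jet_mult _ _ _ _ _ _ _ _ _ _ (jet_const (/ 6)%C) HP3) as HP3'.
    pose proof (jet_plus _ _ _ _ _ _ _ _ _ _ (jet_plus _ _ _ _ _ _ _ _ _ _ (jet_const (RtoC
        1)) HP) (jet_plus _ _ _ _ _ _ _ _ _ _ HP2' HP3')) as J.
    cbv beta in J. destruct J as [R [HR H]]. exists R. split; [easy|]. intros z.
    change (3 + 0)%nat with 3%nat. rewrite !Csum_Sn, Csum_O.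
    unfold exp_coeff. simpl fact.
    replace (INR 1) with 1 by reflexivity. replace (INR 2) with 2 by (simpl; ring).
    replace (INR 6) with 6 by (simpl; ring).
    rewrite Rinv_1, !RtoC_inv by lra.
    transitivity (1 + P z + (/ 2 * (P z * P z) + / 6 * (P z * (P z * P z))))%C; [simpl; cring|].
    rewrite H. field; repeat split; intros E; injection E; lra.
  + destruct IH as [R [HR H]]. pose proof (jet_ispoly _ _ _ _ _ HP) as PP.
    (* Here [P z = z * T z], so the new power is [z^4] times a polynomial and goes into the
       remainder. *)
    destruct HP as [V [HV HPz]]. set (T := fun z => (c1 + z * (c2 + z * (c3 + z * V z)))%C).
    assert (PT : ispoly T) by now repeat apply ispoly_cons.
    exists (fun z => R z + exp_coeff (4 + N) * (T z ^ 4 * P z ^ N))%C. split.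
    * apply ispoly_plus; [easy|]. apply ispoly_scal, ispoly_mult; now apply ispoly_pow.
    * intros z. rewrite Nat.add_succ_r, Csum_Sn, H.
      replace (P z ^ S (3 + N))%C with ((z * T z) ^ 4 * P z ^ N)%C; [simpl; cring|].
      change (S (3 + N)) with (4 + N)%nat. rewrite Cpow_add_r. f_equal. f_equal. rewrite HPz.
      unfold T. ring.
- intros z Hz. specialize (HP' z Hz). specialize (HB z Hz).
  assert (BP : Cmod (P z) <= B + 1).
  { replace (P z) with (F z + - (F z - P z))%C by ring.
    eapply Rle_trans; [apply Cmod_triangle|].
    rewrite Cmod_opp. lra. }
  specialize (HN (3 + N)%nat ltac:(lia) (P z) BP). rewrite Cps_exp in HN.
  set (S := @sum_n C_NormedModule _ _) in *.
  replace (Cexp (F z) - S)%C with (Cexp (P z) * (Cexp (F z - P z) - 1) + (Cexp (P z) - S))%C.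
  2: { assert (E : Cexp (F z) = (Cexp (P z) * Cexp (F z - P z))%C) by (rewrite <- Cexp_plus;
      f_equal; ring).
       rewrite E. ring. }
  eapply Rle_trans; [apply Cmod_triangle|]. rewrite Cmod_mult, Cmod_Cexp.
  assert (L := HL (F z - P z)%C ltac:(lra)).
  assert (M : exp (Re (P z)) <= exp (B + 1)).
  { assert (Re (P z) <= B + 1)
      by (eapply Rle_trans; [apply Rle_abs|eapply Rle_trans; [apply re_le_Cmod|easy]]).
    destruct (Rle_lt_or_eq_dec _ _ H) as [Hlt|Heq];
      [apply Rlt_le, exp_increasing, Hlt|rewrite Heq; lra]. }
  assert (X : exp (Re (P z)) * Cmod (Cexp (F z - P z) - 1) <= exp (B + 1) * (2 * e)).
  { apply Rmult_le_compat; [apply Rlt_le, exp_pos|apply Cmod_ge_0|easy|lra]. }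
  lra.
Qed.

(** * Coefficient inequalities for bounded functions *)

(** The limit [t -> 0] in the form needed by [toeplitz_disk], where rescaling to radius [1 - t]
    costs at most the factor [(1 - t)^6] and approximation raises the bound to [M + t]. *)
Lemma le_of_perturbation X Y M : 0 <= X -> 0 <= Y -> 0 <= M ->
  (forall t, 0 < t < 1 -> (1 - t) ^ 6 * X <= (M + t) ^ 2 * Y) -> X <= M ^ 2 * Y.
Proof.
intros HX HY HM H. apply Rnot_lt_le. intros Hlt.
(* For [t <= 1], the two sides move by at most [6 t X] and [(2 M + 1) t Y]. The added 1 makes [K]
   positive. *)
set (K := 6 * X + (2 * M + 1) * Y + 1).
assert (HK : 1 <= K) by (unfold K; nra).
set (t := Rmin (1 / 2) ((X - M ^ 2 * Y) / (2 * K))).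
assert (T0 : 0 < t) by (apply Rmin_pos; [lra|apply Rdiv_lt_0_compat; lra]).
assert (T1 : t <= 1 / 2) by apply Rmin_l.
assert (T2 : t * (2 * K) <= X - M ^ 2 * Y) by (apply Rle_div_r; [lra|apply Rmin_r]).
specialize (H t ltac:(lra)).
assert (B : 1 - 6 * t <= (1 - t) ^ 6) by nra.
assert (B1 : (1 - 6 * t) * X <= (1 - t) ^ 6 * X) by now apply Rmult_le_compat_r.
assert (B2 : (M + t) ^ 2 * Y <= (M ^ 2 + (2 * M + 1) * t) * Y)
  by (apply Rmult_le_compat_r; nra).
unfold K in T2. nra.
Qed.

Lemma toeplitz_disk F M c1 c2 c3 : 0 <= M -> (forall z, Cmod z < 1 -> Cmod (F z) <= M) ->
  (forall r, 0 < r < 1 -> approx r F (RtoC 0) c1 c2 c3) -> toeplitz_contraction M c1 c2 c3.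
Proof.
intros HM HF HA q0 q1 q2.
pose proof (pow2_ge_0 (Cmod (q0 * c1))) as X1.
pose proof (pow2_ge_0 (Cmod (q0 * c2 + q1 * c1))) as X2.
pose proof (pow2_ge_0 (Cmod (q0 * c3 + q1 * c2 + q2 * c1))) as X3.
pose proof (pow2_ge_0 (Cmod q0)) as Y1. pose proof (pow2_ge_0 (Cmod q1)) as Y2.
pose proof (pow2_ge_0 (Cmod q2)) as Y3.
(* A single [t] serves both as distance of the radius from 1 and as approximation error. *)
apply le_of_perturbation; [lra|lra|easy|]. intros t Ht. set (r := 1 - t).
assert (Hr : 0 < r < 1) by (unfold r; lra).
destruct (HA r Hr t ltac:(lra)) as [P [HP HP']].
assert (J := jet_scale (RtoC r) P _ _ _ _ HP).
assert (T := toeplitz_poly _ (M + t) _ _ _ J).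
assert (Tw : forall w, Cmod w = 1 -> Cmod (P (r * w)%C) <= M + t).
{ intros w Hw.
  assert (Z : Cmod (r * w)%C = r) by (rewrite Cmod_mult, Hw, Cmod_R, Rabs_pos_eq; lra).
  replace (P (r * w)%C) with (F (r * w) + - (F (r * w) - P (r * w)))%C by ring.
  eapply Rle_trans; [apply Cmod_triangle|]. rewrite Cmod_opp.
  apply Rplus_le_compat; [apply HF|apply HP']; lra. }
(* Scaling the test vector like the jet makes the three output coefficients factor as [r], [r^2] and
   [r^3] times the unscaled ones. *)
specialize (T Tw q0 (r * q1)%C (r ^ 2 * q2)%C).
replace (q0 * (r * c1))%C with (r * (q0 * c1))%C in T by ring.
replace (q0 * (r ^ 2 * c2) + r * q1 * (r * c1))%C with (r ^ 2 * (q0 * c2 + q1 * c1))%C in T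
  by ring.
replace (q0 * (r ^ 3 * c3) + r * q1 * (r ^ 2 * c2) + r ^ 2 * q2 * (r * c1))%C
  with (r ^ 3 * (q0 * c3 + q1 * c2 + q2 * c1))%C in T by ring.
rewrite !(Cmod_mult (RtoC r)), !(Cmod_mult (RtoC r ^ _)%C), !Cmod_pow, Cmod_R, (Rabs_pos_eq
    r), !Rpow_mult_distr in T by lra.
rewrite <- !pow_mult in T. simpl Nat.mul in T.
assert (R2 : r ^ 2 <= 1) by (simpl; nra).
assert (R0 : 0 <= r ^ 2) by apply pow2_ge_0.
assert (R4 : r ^ 4 <= 1) by (replace (r ^ 4) with (r ^ 2 * r ^ 2) by ring; nra).
assert (R42 : r ^ 4 <= r ^ 2) by (replace (r ^ 4) with (r ^ 2 * r ^ 2) by ring; nra).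
assert (R04 : 0 <= r ^ 4) by (apply pow_le; lra).
assert (R64 : r ^ 6 <= r ^ 4) by (replace (r ^ 6) with (r ^ 4 * r ^ 2) by ring; nra).
eapply Rle_trans; [|eapply Rle_trans; [apply T|]].
- rewrite !Rmult_plus_distr_l. repeat apply Rplus_le_compat; apply Rmult_le_compat_r; lra.
- apply Rmult_le_compat_l; [apply pow2_ge_0|].
  assert (r ^ 2 * Cmod q1 ^ 2 <= 1 * Cmod q1 ^ 2) by now apply Rmult_le_compat_r.
  assert (r ^ 4 * Cmod q2 ^ 2 <= 1 * Cmod q2 ^ 2) by now apply Rmult_le_compat_r.
  lra.
Qed.

Lemma pow2_le_1 x : 0 <= x -> x ^ 2 <= 1 -> x <= 1.
Proof. intros. nra. Qed.

Lemma toeplitz_bessel c1 c2 c3 : toeplitz_contraction 1 c1 c2 c3 ->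
  Cmod c1 ^ 2 + Cmod c2 ^ 2 + Cmod c3 ^ 2 <= 1.
Proof.
intros T. specialize (T (RtoC 1) (RtoC 0) (RtoC 0)).
rewrite !Cmult_0_l, !Cmult_1_l, !Cplus_0_r, Cmod_1, Cmod_0 in T. lra.
Qed.

Lemma toeplitz_second c1 c2 c3 : toeplitz_contraction 1 c1 c2 c3 -> Cmod (c2 + c1 ^ 2)%C <= 1.
Proof.
intros T. specialize (T (RtoC 1) c1 (RtoC 0)).
replace (1 * c2 + c1 * c1)%C with (c2 + c1 ^ 2)%C in T by ring.
rewrite Cmult_1_l, Cmod_1, Cmod_0 in T. apply pow2_le_1; [apply Cmod_ge_0|].
pose proof (pow2_ge_0 (Cmod (1 * c3 + c1 * c2 + 0 * c1))). lra.
Qed.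

(* [q] is the truncation of [1 / (1 - w)]: since [w / (1 - w) = 1 / (1 - w) - 1],
   all squares but the last one cancel. *)
Lemma toeplitz_third c1 c2 c3 : toeplitz_contraction 1 c1 c2 c3 ->
  Cmod (c3 + 2 * c1 * c2 + c1 ^ 3)%C <= 1.
Proof.
intros T. specialize (T (RtoC 1) c1 (c2 + c1 ^ 2)%C).
replace (1 * c2 + c1 * c1)%C with (c2 + c1 ^ 2)%C in T by ring.
replace (1 * c3 + c1 * c2 + (c2 + c1 ^ 2) * c1)%C with (c3 + 2 * c1 * c2 + c1 ^ 3)%C in T
  by ring.
rewrite Cmult_1_l, Cmod_1 in T. apply pow2_le_1; [apply Cmod_ge_0|]. lra.
Qed.

(** The same cancellation, now from [w / (1 + w) = 1 - 1 / (1 + w)]. *)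
Lemma toeplitz_third_opp c1 c2 c3 : toeplitz_contraction 1 c1 c2 c3 ->
  Cmod (c3 - 2 * c1 * c2 + c1 ^ 3)%C <= 1.
Proof.
intros T. specialize (T (RtoC 1) (- c1)%C (- (c2 - c1 ^ 2))%C).
replace (1 * c2 + - c1 * c1)%C with (c2 - c1 ^ 2)%C in T by ring.
replace (1 * c3 + - c1 * c2 + - (c2 - c1 ^ 2) * c1)%C with (c3 - 2 * c1 * c2 + c1 ^ 3)%C in T
  by ring.
rewrite Cmult_1_l, Cmod_1, !Cmod_opp in T. apply pow2_le_1; [apply Cmod_ge_0|]. lra.
Qed.

Lemma Cmod_convex (t : R) x y B : 0 <= t <= 1 -> Cmod x <= B -> Cmod y <= B ->
  Cmod (t * x + (1 - t) * y)%C <= B.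
Proof.
intros Ht Hx Hy. eapply Rle_trans; [apply Cmod_triangle|].
rewrite <- RtoC_minus, !Cmod_mult, !Cmod_R, !Rabs_pos_eq by lra. nra.
Qed.

(** Up to [k = 1], interpolation between [k = 0] (Bessel) and [k = 1]. Beyond that, the excess
    [(k - 1) c1^2] adds at most [k - 1]. *)
Lemma fekete_szego c1 c2 c3 (k : R) : toeplitz_contraction 1 c1 c2 c3 -> 0 <= k ->
  Cmod (c2 + k * c1 ^ 2)%C <= Rmax 1 k.
Proof.
intros T Hk. pose proof (toeplitz_second _ _ _ T) as T2.
pose proof (toeplitz_bessel _ _ _ T) as T1.
pose proof (Cmod_ge_0 c1) as N1. pose proof (Cmod_ge_0 c2) as N2.
pose proof (pow2_ge_0 (Cmod c3)) as N3.
pose proof (pow2_ge_0 (Cmod c1)).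
destruct (Rle_dec k 1) as [H1|H1].
- rewrite Rmax_left by easy.
  replace (c2 + k * c1 ^ 2)%C with (k * (c2 + c1 ^ 2) + (1 - k) * c2)%C by ring.
  apply Cmod_convex; [lra|easy|]. apply pow2_le_1; lra.
- rewrite Rmax_right by lra.
  replace (c2 + k * c1 ^ 2)%C with ((c2 + c1 ^ 2) + RtoC (k - 1) * c1 ^ 2)%C
    by (rewrite RtoC_minus; ring).
  eapply Rle_trans; [apply Cmod_triangle|].
  rewrite Cmod_mult, Cmod_R, Cmod_pow, Rabs_pos_eq by lra.
  pose proof (pow2_ge_0 (Cmod c2)). nra.
Qed.

Lemma prokhorov_szynal_nu_1 c1 c2 c3 (m : R) : toeplitz_contraction 1 c1 c2 c3 -> 0 <= m <= 2 ->
  Cmod (c3 + m * c1 * c2 + c1 ^ 3)%C <= 1.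
Proof.
intros T Hm.
(* The weight [(2 + m) / 4] places [m] on the segment from -2 to 2, whose ends are the two
   inequalities obtained by testing. *)
replace (c3 + m * c1 * c2 + c1 ^ 3)%C with
 (RtoC ((2 + m) / 4) * (c3 + 2 * c1 * c2 + c1 ^ 3) + (1 - RtoC ((2 + m) / 4)) * (c3 - 2 * c1
     * c2 + c1 ^ 3))%C.
- apply Cmod_convex; [lra|now apply toeplitz_third|now apply toeplitz_third_opp].
- rewrite RtoC_div, RtoC_plus by lra. field.
Qed.

(** Interpolation in [n] between 0 and 1. At [n = 0], with moduli [x, y, z], one has
    [z + x y <= z + (1 - z^2) / 2 <= 1] by Bessel. *)
Lemma prokhorov_szynal_small c1 c2 c3 (m n : R) : toeplitz_contraction 1 c1 c2 c3 ->
  0 <= m <= 1 -> 0 <= n <= 1 ->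
  Cmod (c3 + m * c1 * c2 + n * c1 ^ 3)%C <= 1.
Proof.
intros T Hm Hn. pose proof (toeplitz_bessel _ _ _ T) as T1.
replace (c3 + m * c1 * c2 + n * c1 ^ 3)%C with
 (n * (c3 + m * c1 * c2 + c1 ^ 3) + (1 - n) * (c3 + m * c1 * c2))%C by ring.
apply Cmod_convex; [easy|apply prokhorov_szynal_nu_1; [easy|lra]|].
eapply Rle_trans; [apply Cmod_triangle|]. rewrite !Cmod_mult, Cmod_R, Rabs_pos_eq by lra.
pose proof (Cmod_ge_0 c1). pose proof (Cmod_ge_0 c2). pose proof (Cmod_ge_0 c3).
set (x := Cmod c1) in *. set (y := Cmod c2) in *. set (z := Cmod c3) in *.
assert (0 <= x * y) by nra. assert (m * x * y <= x * y) by nra.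
pose proof (pow2_ge_0 (x - y)). pose proof (pow2_ge_0 (1 - z)). nra.
Qed.

(** Relative to [n = 1], the extra cubic term adds at most [n - 1]. *)
Lemma prokhorov_szynal_large c1 c2 c3 (m n : R) : toeplitz_contraction 1 c1 c2 c3 ->
  0 <= m <= 2 -> 1 <= n ->
  Cmod (c3 + m * c1 * c2 + n * c1 ^ 3)%C <= n.
Proof.
intros T Hm Hn. pose proof (toeplitz_bessel _ _ _ T) as T1.
replace (c3 + m * c1 * c2 + n * c1 ^ 3)%C with
 ((c3 + m * c1 * c2 + c1 ^ 3) + RtoC (n - 1) * c1 ^ 3)%C by (rewrite RtoC_minus; ring).
eapply Rle_trans; [apply Cmod_triangle|].
rewrite Cmod_mult, Cmod_R, Cmod_pow, Rabs_pos_eq by lra.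
pose proof (prokhorov_szynal_nu_1 _ _ _ m T Hm).
assert (Cmod c1 ^ 3 <= 1).
{ rewrite <- (pow1 3). apply pow_incr. split; [apply Cmod_ge_0|].
  apply pow2_le_1; [apply Cmod_ge_0|].
  pose proof (pow2_ge_0 (Cmod c2)). pose proof (pow2_ge_0 (Cmod c3)). lra. }
nra.
Qed.

Lemma toeplitz_normalize M c1 c2 c3 : 0 < M -> toeplitz_contraction M c1 c2 c3 ->
  toeplitz_contraction 1 (c1 / M) (c2 / M) (c3 / M).
Proof.
intros HM T q0 q1 q2. specialize (T q0 q1 q2).
assert (HM' : RtoC M <> RtoC 0) by (intros E; injection E; lra).
replace (q0 * (c1 / M))%C with ((q0 * c1) / M)%C by (field; easy).
replace (q0 * (c2 / M) + q1 * (c1 / M))%C with ((q0 * c2 + q1 * c1) / M)%C by (field; easy).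
replace (q0 * (c3 / M) + q1 * (c2 / M) + q2 * (c1 / M))%C with ((q0 * c3 + q1 * c2 + q2 * c1)
    / M)%C by (field; easy).
rewrite !Cmod_div, Cmod_R, (Rabs_pos_eq M) by (easy || lra).
apply Rmult_le_reg_l with (M ^ 2); [apply pow_lt; lra|].
eapply Rle_trans; [|rewrite pow1, Rmult_1_l; apply T].
apply Req_le. field. lra.
Qed.

(** * The class U and its logarithmic coefficients *)

Lemma class_A_0 f : class_A f -> f (RtoC 0) = RtoC 0.
Proof.
intros [_ [a [a0 [_ H]]]]. rewrite <- a0 at 2. rewrite <- Cps_0. symmetry. apply Cser_unique.
refine (proj1 (Cis_pseries a _ _) (H _ _)).
unfold in_disk. rewrite Cmod_0. lra.
Qed.

(** The class is defined by a logarithm of [z / f], the coefficients by one of [f / z]. Their sum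
    [S] satisfies [Cexp S = 1]; differentiating gives [S' = 0], and [S 0 = 0] excludes nonzero
    multiples of the period. *)
Lemma log_branch_opp f L L1 : (forall z, in_disk z -> z <> RtoC 0 -> f z <> RtoC 0) ->
  log_branch (over_id f) L -> log_branch (id_over f) L1 ->
  forall z, in_disk z -> L1 z = (- L z)%C.
Proof.
intros Hf [A [L0 E]] [A1 [L10 E1]] z Hz.
set (S := fun w => (L1 w + L w)%C).
assert (ES : forall w, Cmod w < 1 -> Cexp (S w) = RtoC 1).
{ intros w Hw. unfold S. rewrite Cexp_plus, E, E1 by easy.
  unfold id_over, over_id. destruct (Ceq_dec w (RtoC 0)) as [H|H]; [ring|].
  field. split; [easy|now apply Hf]. }
assert (DS : forall w, Cmod w < 1 -> Cder S w (RtoC 0)).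
{ intros w Hw. destruct (A w Hw) as [d Hd]. destruct (A1 w Hw) as [d1 Hd1].
  assert (D := Cder_plus _ _ _ _ _ Hd1 Hd).
  assert (D2 := Cexp_comp_Cder _ _ _ D).
  change (Cder (fun w => Cexp (S w)) w ((d1 + d) * Cexp (S w))%C) in D2.
  assert (D3 := Cder_ext_disk _ _ 1 w _ ES Hw D2).
  assert (U := Cder_unique _ _ _ _ D3 (Cder_const (RtoC 1) w)).
  rewrite ES, Cmult_1_r in U by easy. rewrite <- U. exact D. }
assert (K := Cder_zero_const S 1 z DS Hz). unfold S in K. rewrite L0, L10 in K.
replace (L1 z) with ((L1 z + L z) - L z)%C by ring. rewrite K. ring.
Qed.

(** Taylor coefficients of [log (f(z)/z)]; the constant term is 0 whatever value [gamma 0] has. *)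
Definition log_series (gamma : nat -> C) (k : nat) : C :=
  match k with O => RtoC 0 | S _ => (2 * gamma k)%C end.

Lemma log_coeffs_series f gamma : log_coeffs f gamma ->
  (forall r, 0 <= r < 1 -> summable (log_series gamma) r) /\
  log_branch (over_id f) (Cps (log_series gamma)).
Proof.
intros [L [[HA [H0 HL]] Hs]].
assert (S1 : forall z, Cmod z < 1 -> Cis_series (fun k => log_series gamma k * z ^ k)%C (L z)).
{ intros z Hz. destruct (Hs z Hz) as [s [Hss ->]].
  refine (proj1 (Cis_series_S (fun k => log_series gamma k * z ^ k)%C _) _).
  replace (2 * s - log_series gamma 0 * z ^ 0)%C with (2 * s)%C by (simpl; ring).
  apply Cis_series_ext with (2 := Cis_series_scal (RtoC 2) _ _ Hss). intros n. simpl. ring. }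
assert (SM : forall r, 0 <= r < 1 -> summable (log_series gamma) r).
{ intros r Hr. apply summable_of_conv with 1; [|easy]. intros z Hz. eexists. now apply S1. }
assert (E : forall z, Cmod z < 1 -> Cps (log_series gamma) z = L z)
  by (intros; apply Cser_unique, S1; easy).
split; [easy|]. split; [|split].
- intros z Hz. pose proof (Cmod_ge_0 z). unfold in_disk in Hz.
  exists (Cps (Cps_derive (log_series gamma)) z).
  apply (Cps_Cder _ ((Cmod z + 1) / 2)); [apply SM|]; lra.
- now rewrite Cps_0.
- intros z Hz. rewrite E by easy. now apply HL.
Qed.

Lemma class_U_toeplitz alpha lambda f gamma : 0 <= lambda -> class_U alpha lambda f ->
  log_coeffs f gamma ->
  let l1 := (2 * gamma 1%nat)%C in let l2 := (2 * gamma 2%nat)%C in let l3 := (2 * gamma 3%nat)%C in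
  toeplitz_contraction lambda ((1 - alpha) * l1) ((2 - alpha) * (l2 - alpha * l1 ^ 2 / 2))
    ((3 - alpha) * (l3 - alpha * l1 * l2 + alpha ^ 2 * l1 ^ 3 / 6)).
Proof.
intros Hl [HA [Hnz [h [[L1 [HL1 Hh]] HU]]]] HG l1 l2 l3.
apply log_coeffs_series in HG. destruct HG as [SM HL].
set (l := log_series gamma) in *. set (L := Cps l) in *.
assert (HL1E := log_branch_opp f L L1 Hnz HL HL1).
set (L' := Cps (Cps_derive l)).
assert (DL : forall z, Cmod z < 1 -> Cder L z (L' z)).
{ intros z Hz. pose proof (Cmod_ge_0 z).
  apply (Cps_Cder _ ((Cmod z + 1) / 2)); [apply SM|]; lra. }
assert (Ef : forall z, Cmod z < 1 -> f z = (z * Cexp (L z))%C).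
{ intros z Hz. destruct HL as [_ [_ HL]]. rewrite HL by easy. unfold over_id.
  destruct (Ceq_dec z (RtoC 0)) as [->|H]; [rewrite class_A_0 by easy; ring|]. now field. }
assert (Df : forall z, Cmod z < 1 -> C_derive f z = (Cexp (L z) * (1 + z * L' z))%C).
{ intros z Hz. apply is_C_derive_unique.
  apply (Cder_ext_disk (fun w => w * Cexp (L w))%C f 1 z); [intros; now rewrite Ef|easy|].
  replace (Cexp (L z) * (1 + z * L' z))%C with (1 * Cexp (L z) + z * (L' z * Cexp (L z)))%C
    by ring.
  apply (Cder_mult (fun w => w) (fun w => Cexp (L w))); [apply Cder_id|].
  apply (Cexp_comp_Cder L). now apply DL. }
apply (toeplitz_disk (fun z => Cexp (- alpha * L z) * (1 + z * L' z) + - (1))%C); [easy| |].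
- intros z Hz. specialize (HU z Hz). rewrite Hh, Df, HL1E in HU by easy.
  (* One factor [Cexp (- L)] is split off to cancel the [Cexp (L)] coming from the derivative of
     [f = z * Cexp (L z)]. *)
  replace (RtoC (1 + alpha) * - L z)%C with (- alpha * L z + - L z)%C in HU
    by (rewrite RtoC_plus; ring).
  rewrite Cexp_plus, Cexp_opp in HU.
  replace (Cexp (- alpha * L z) * (1 + z * L' z) + - (1))%C
   with (Cexp (- alpha * L z) * / Cexp (L z) * (Cexp (L z) * (1 + z * L' z)) - 1)%C; [lra|].
  field. apply Cexp_nz.
- intros r Hr. assert (Hr0 : 0 <= r) by lra.
  assert (AL := approx_ps r l Hr0 (SM r ltac:(lra))).
  assert (AE : approx r (fun z => - alpha * L z)%C (RtoC 0) (- alpha * l1) (- alpha * l2) (-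
      alpha * l3)).
  { refine (approx_eq r _ _ _ _ _ _ _ _ _ _ _ _ _ (approx_mult r _ _ _ _ _ _ _ _ _ _ Hr0
        (approx_jet r _ _ _ _ _ (jet_const (- alpha)%C)) AL));
    unfold l; simpl log_series; fold l1 l2 l3; ring. }
  assert (SD : summable (Cps_derive l) r)
    by (apply (summable_derive l r ((r + 1) / 2)); [lra|apply SM; lra]).
  assert (AD := approx_ps r _ Hr0 SD).
  assert (JI : jet (fun z => z) (RtoC 0) (RtoC 1) (RtoC 0) (RtoC 0)).
  { exists (fun _ => RtoC 0). split; [apply ispoly_const|intros; ring]. }
  assert (AZ := approx_plus r _ _ _ _ _ _ _ _ _ _ (approx_jet r _ _ _ _ _ (jet_const (RtoC
      1))) (approx_mult r _ _ _ _ _ _ _ _ _ _ Hr0 (approx_jet r _ _ _ _ _ JI) AD)).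
  apply (approx_exp r _ _ _ _ Hr0) in AE.
  assert (AF := approx_plus r _ _ _ _ _ _ _ _ _ _ (approx_mult r _ _ _ _ _ _ _ _ _ _ Hr0 AE
      AZ) (approx_jet r _ _ _ _ _ (jet_const (- (1))%C))).
  refine (approx_eq r _ _ _ _ _ _ _ _ _ _ _ _ _ AF); unfold Cps_derive, l; simpl log_series;
      fold l1 l2 l3;
   replace (INR 1) with 1 by reflexivity; replace (INR 2) with 2
     by (simpl; ring); replace (INR 3) with 3 by (simpl; ring);
   field; repeat split; intros E; injection E; lra.
Qed.

(** * Extremal functions *)

Definition geom_coeff (k : nat) : C := RtoC 1.

Lemma summable_geom r : 0 <= r < 1 -> summable geom_coeff r.
Proof.
intros Hr. apply summable_of_bounded with 1 1; [lra|]. intros k. unfold geom_coeff.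
rewrite Cmod_1, pow1. lra.
Qed.

Lemma Cps_geom w : Cmod w < 1 -> ((1 - w) * Cps geom_coeff w)%C = RtoC 1.
Proof.
intros Hw. pose proof (Cmod_ge_0 w).
assert (T := Cps_correct geom_coeff (Cmod w) w (summable_geom (Cmod w) ltac:(lra)) (Rle_refl _)).
assert (T1 := proj2 (Cis_series_S _ _) T).
assert (T2 := Cis_series_scal w _ _ T).
assert (E : (w * Cps geom_coeff w)%C = (Cps geom_coeff w - 1)%C).
{ transitivity (Cser (fun k => geom_coeff (S k) * w ^ S k)%C).
  - rewrite <- (Cser_unique _ _ T2). apply Cser_ext. intros k. unfold geom_coeff. simpl. ring.
  - rewrite (Cser_unique _ _ T1). unfold geom_coeff. simpl. ring. }
replace ((1 - w) * Cps geom_coeff w)%C with (Cps geom_coeff w - w * Cps geom_coeff w)%C by ring.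
rewrite E. ring.
Qed.

(** Taylor coefficients of [- log (1 - w)]. *)
Definition log_coeff (k : nat) : C := match k with O => RtoC 0 | S _ => RtoC (/ INR k) end.

Lemma summable_log r : 0 <= r < 1 -> summable log_coeff r.
Proof.
intros Hr. apply summable_of_bounded with 1 1; [lra|].
intros [|k]; unfold log_coeff; rewrite pow1, Rmult_1_r.
- rewrite Cmod_0. lra.
- assert (1 <= INR (S k)) by (rewrite S_INR; pose proof (pos_INR k); lra).
  rewrite Cmod_R, Rabs_pos_eq by (apply Rlt_le, Rinv_0_lt_compat; lra).
  rewrite <- Rinv_1. apply Rinv_le_contravar; lra.
Qed.

Lemma Cps_log_Cder w : Cmod w < 1 -> Cder (Cps log_coeff) w (Cps geom_coeff w).
Proof.
intros Hw. pose proof (Cmod_ge_0 w).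
rewrite (Cps_ext geom_coeff (Cps_derive log_coeff)).
- apply (Cps_Cder _ ((Cmod w + 1) / 2)); [apply summable_log|]; lra.
- intros k. unfold geom_coeff, Cps_derive, log_coeff. rewrite <- RtoC_mult. f_equal.
  field. apply not_0_INR. lia.
Qed.

Lemma Cexp_log w : Cmod w < 1 -> ((1 - w) * Cexp (Cps log_coeff w))%C = RtoC 1.
Proof.
intros Hw.
set (F := fun w => ((1 + - (1) * w) * Cexp (Cps log_coeff w))%C).
assert (D : forall w, Cmod w < 1 -> Cder F w (RtoC 0)).
{ clear w Hw. intros w Hw.
  assert (D := Cder_mult _ _ _ _ _ (Cder_plus _ _ _ _ _ (Cder_const (RtoC 1) w) (Cder_scal (-
      (1))%C _ _ _ (Cder_id w)))
    (Cexp_comp_Cder _ _ _ (Cps_log_Cder w Hw))).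
  match type of D with Cder _ _ ?d => replace (RtoC 0) with d; [exact D|] end.
  pose proof (Cps_geom w Hw) as G.
  replace (_ + _)%C with (- Cexp (Cps log_coeff w) + (1 - w) * Cps geom_coeff w * Cexp (Cps
      log_coeff w))%C by ring.
  rewrite G. ring. }
replace (_ * _)%C with (F w) by (unfold F; ring).
rewrite (Cder_zero_const F 1 w D Hw). unfold F. rewrite Cps_0. simpl. rewrite Cexp_0. ring.
Qed.

(* Taylor coefficients of [(1 - w) ^ (- b)]. *)
Fixpoint binom_coeff (b : R) (k : nat) : R :=
  match k with O => 1 | S j => binom_coeff b j * ((b + INR j) / INR (S j)) end.

Lemma binom_coeff_pos b k : 0 < b -> 0 < binom_coeff b k.
Proof.
intros Hb. induction k as [|k IH]; [simpl; lra|]. cbn [binom_coeff].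
apply Rmult_lt_0_compat; [easy|].
apply Rdiv_lt_0_compat; [pose proof (pos_INR k); lra|apply lt_0_INR; lia].
Qed.

Lemma summable_binom b r : 0 < b -> 0 <= r < 1 -> summable (fun k => RtoC (binom_coeff b k)) r.
Proof.
(* [r] may be 0, while the ratio test needs nonzero terms; a larger positive radius is used
   instead. *)
intros Hb Hr. apply summable_le with ((r + 1) / 2); [lra|]. set (s := (r + 1) / 2).
assert (Hs : 0 < s < 1) by (unfold s; lra).
assert (P : forall k, 0 < binom_coeff b k * s ^ k)
  by (intros k; apply Rmult_lt_0_compat; [now apply binom_coeff_pos|apply pow_lt; lra]).
apply ex_series_ext with (fun k => Rabs (binom_coeff b k * s ^ k)).
{ intros k. rewrite Rabs_mult, Cmod_R. f_equal. apply Rabs_pos_eq, pow_le. lra. }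
apply ex_series_DAlembert with s; [easy|intros n; specialize (P n); lra|].
apply is_lim_seq_ext with (fun n => (1 + (b - 1) * / INR (S n)) * s).
{ intros n. symmetry.
  assert (0 < INR (S n)) by (apply lt_0_INR; lia).
  replace (_ / _) with ((1 + (b - 1) * / INR (S n)) * s).
  - apply Rabs_pos_eq. apply Rmult_le_pos; [|lra].
    replace (1 + _) with ((b + INR n) / INR (S n)) by (rewrite S_INR in *; field; lra).
    apply Rdiv_le_0_compat; [pose proof (pos_INR n); lra|easy].
  - pose proof (binom_coeff_pos b n Hb). assert (0 < s ^ n) by (apply pow_lt; lra).
    cbn [binom_coeff pow]. rewrite S_INR in *. field. repeat split; lra. }
replace (Finite s) with (Rbar_mult (1 + (b - 1) * 0) s) by (simpl; f_equal; ring).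
apply is_lim_seq_scal_r.
apply (is_lim_seq_plus' (fun _ => 1) (fun n => (b - 1) * / INR (S n)) 1 ((b - 1) * 0));
  [apply is_lim_seq_const|].
apply (is_lim_seq_scal_l (fun n => / INR (S n)) (b - 1) 0).
apply (is_lim_seq_inv (fun n => INR (S n)) p_infty); [|easy].
apply (is_lim_seq_incr_1 INR). apply is_lim_seq_INR.
Qed.

(** [class_A] asks for a power series, whereas the extremal function is given by an exponential. The
    binomial series [B] and that exponential both solve [(1 - w) y' = b y], so their quotient has
    derivative 0. *)
Lemma Cps_binom b w : 0 < b -> Cmod w < 1 ->
  Cps (fun k => RtoC (binom_coeff b k)) w = Cexp (b * Cps log_coeff w)%C.
Proof.
intros Hb Hw. set (a := fun k => RtoC (binom_coeff b k)).
set (B := Cps a). set (B' := Cps (Cps_derive a)).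
assert (SB : forall r, 0 <= r < 1 -> summable a r) by (intros; now apply summable_binom).
assert (DB : forall w, Cmod w < 1 -> Cder B w (B' w)).
{ clear w Hw. intros w Hw. pose proof (Cmod_ge_0 w).
  apply (Cps_Cder _ ((Cmod w + 1) / 2)); [apply SB|]; lra. }
(* Termwise this is the recurrence [(k + 1) a (k + 1) = (b + k) a k]. *)
assert (ODE : forall w, Cmod w < 1 -> ((1 - w) * B' w)%C = (b * B w)%C).
{ clear w Hw. intros w Hw. pose proof (Cmod_ge_0 w).
  assert (T : Cis_series (fun k => a k * w ^ k)%C (B w))
    by exact (Cps_correct a (Cmod w) w (SB (Cmod w) ltac:(lra)) (Rle_refl _)).
  assert (T' : Cis_series (fun k => Cps_derive a k * w ^ k)%C (B' w)).
  { apply (Cps_correct _ (Cmod w)); [|lra].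
    apply (summable_derive a _ ((Cmod w + 1) / 2)); [lra|apply SB; lra]. }
  assert (T1 : Cis_series (fun k => INR k * a k * w ^ k)%C (w * B' w)%C).
  { refine (proj1 (Cis_series_S _ _) _). simpl (INR 0).
    replace (w * B' w - 0 * a 0%nat * w ^ 0)%C with (w * B' w)%C by ring.
    apply Cis_series_ext with (2 := Cis_series_scal w _ _ T'). intros k. unfold Cps_derive.
    simpl Cpow. ring. }
  assert (T2 := Cis_series_plus _ _ _ _ (Cis_series_scal b _ _ T) T1).
  assert (E : B' w = (b * B w + w * B' w)%C).
  { rewrite <- (Cser_unique _ _ T2), <- (Cser_unique _ _ T'). apply Cser_ext. intros k.
    unfold Cps_derive, a. cbn [binom_coeff].
    assert (Hk : INR (S k) <> 0) by (apply not_0_INR; lia).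
    rewrite RtoC_mult, RtoC_div, RtoC_plus by easy. field.
    intros E. now injection E. }
  replace ((1 - w) * B' w)%C with (B' w - w * B' w)%C by ring. rewrite E at 1. ring. }
set (F := fun w => (B w * Cexp (- b * Cps log_coeff w))%C).
assert (D : forall w, Cmod w < 1 -> Cder F w (RtoC 0)).
{ clear w Hw. intros w Hw.
  assert (D := Cder_mult _ _ _ _ _ (DB w Hw) (Cexp_comp_Cder _ _ _ (Cder_scal (- b)%C _ _ _
      (Cps_log_Cder w Hw)))).
  match type of D with Cder _ _ ?d => replace (RtoC 0) with d; [exact D|] end.
  pose proof (Cps_geom w Hw) as G. pose proof (ODE w Hw) as O.
  set (e := Cexp _). set (g := Cps geom_coeff w) in *.
  (* Each bracket vanishes, the first by [Cps_geom] and the second by [ODE]. *)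
  transitivity (B' w * e * (1 - (1 - w) * g) + ((1 - w) * B' w - b * B w) * g * e)%C; [ring|].
  rewrite G, O. ring. }
assert (K := Cder_zero_const F 1 w D Hw). unfold F, B in K. rewrite !Cps_0 in K.
unfold a in K at 2. simpl in K.
replace (- b * 0)%C with (RtoC 0) in K by ring. rewrite Cexp_0, Cmult_1_l in K.
replace (- b * Cps log_coeff w)%C with (- (b * Cps log_coeff w))%C in K by ring.
fold B in K |- *.
rewrite <- (Cmult_1_r (B w)), <- (Cexp_opp_r (b * Cps log_coeff w)), (Cmult_comm (Cexp _)),
    Cmult_assoc, K. ring.
Qed.

(* Coefficients in [z] of a power series in [z ^ n]. *)
Definition inflate (n : nat) (a : nat -> C) (m : nat) : C :=
  if (m mod n =? 0)%nat then a (m / n)%nat else RtoC 0.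

Lemma inflate_mul n a j : (0 < n)%nat -> inflate n a (n * j) = a j.
Proof.
intros Hn. unfold inflate. rewrite Nat.mul_comm, Nat.Div0.mod_mul, Nat.div_mul by lia.
reflexivity.
Qed.

Lemma inflate_sum n a z m : (0 < n)%nat ->
  @sum_n C_NormedModule (fun k => inflate n a k * z ^ k)%C m =
  @sum_n C_NormedModule (fun k => a k * (z ^ n) ^ k)%C (m / n).
Proof.
intros Hn. induction m as [|m IH].
- rewrite Nat.Div0.div_0_l, !Csum_O. unfold inflate.
  rewrite Nat.Div0.mod_0_l, Nat.Div0.div_0_l. reflexivity.
- rewrite Csum_Sn, IH. unfold inflate.
  pose proof (Nat.div_mod_eq (S m) n) as E1. pose proof (Nat.div_mod_eq m n) as E2.
  pose proof (Nat.mod_upper_bound (S m) n ltac:(lia)).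
  pose proof (Nat.mod_upper_bound m n ltac:(lia)).
  destruct (Nat.eqb_spec (S m mod n) 0) as [H1|H1].
  + assert (E : (S m / n = S (m / n))%nat) by nia.
    rewrite E, Csum_Sn. f_equal. f_equal. rewrite <- Cpow_mult_r. f_equal. nia.
  + assert (E : (S m / n = m / n)%nat) by nia. rewrite E. cring.
Qed.

Lemma inflate_series n a z s : (0 < n)%nat -> Cis_series (fun k => a k * (z ^ n) ^ k)%C s ->
  Cis_series (fun k => inflate n a k * z ^ k)%C s.
Proof.
intros Hn H. apply Cis_series_eps. intros eps He.
destruct (proj1 (Cis_series_eps _ _) H eps He) as [N HN].
exists (N * n)%nat. intros m Hm. rewrite inflate_sum by easy. apply HN.
apply Nat.div_le_lower_bound; lia.
Qed.

(** With [W = k z^n] and [L = - log (1 - W) / alpha], one has [exp (- alpha L) = 1 - W] and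
    [z L' = n W / (alpha (1 - W))]. Letting [j] vary makes the single function for [n = 1] serve the
    first, second and third coefficients. *)
Lemma extremal_function alpha lambda n : 0 < alpha < 1 -> 0 < lambda -> (0 < n)%nat ->
  alpha * lambda / (INR n - alpha) < 1 ->
  exists f gamma, class_U alpha lambda f /\ log_coeffs f gamma /\
   forall j, (0 < j)%nat ->
     gamma (n * j)%nat = RtoC ((alpha * lambda / (INR n - alpha)) ^ j / (2 * alpha * INR j)).
Proof.
intros Ha Hl Hn. set (k := alpha * lambda / (INR n - alpha)). intros Hk1.
assert (Hn1 : 1 <= INR n) by (apply (le_INR 1); lia).
assert (Hk0 : 0 < k) by (apply Rdiv_lt_0_compat; nra).
set (b := / alpha). assert (Hb : 0 < b) by (apply Rinv_0_lt_compat; lra).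
set (W := fun z => (k * z ^ n)%C).
assert (HW : forall z, Cmod z < 1 -> Cmod (W z) < 1).
{ intros z Hz. unfold W. rewrite Cmod_mult, Cmod_R, Cmod_pow, Rabs_pos_eq by lra.
  assert (Cmod z ^ n <= 1)
    by (rewrite <- (pow1 n); apply pow_incr; split; [apply Cmod_ge_0|lra]).
  pose proof (pow_le _ n (Cmod_ge_0 z)). nra. }
set (L := fun z => (b * Cps log_coeff (W z))%C).
set (f := fun z => (z * Cexp (L z))%C).
assert (L0 : L (RtoC 0) = RtoC 0).
{ unfold L, W. destruct n; [lia|]. simpl. rewrite Cmult_0_l, Cmult_0_r, Cps_0. simpl. ring. }
assert (DL : forall z, Cmod z < 1 -> exists d, Cder L z d /\ (z * d)%C = (b * INR n * W z *
    Cps geom_coeff (W z))%C).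
{ intros z Hz. destruct n as [|n']; [lia|].
  eexists. split.
  - apply (Cder_scal b (fun z => Cps log_coeff (W z))).
    apply (Cder_comp (Cps log_coeff) W).
    + apply Cps_log_Cder. now apply HW.
    + apply (Cder_scal k (fun z => z ^ S n')%C). apply Cder_pow.
  - unfold W. simpl Cpow. ring. }
assert (EW : forall z, Cmod z < 1 -> Cexp (- Cps log_coeff (W z))%C = (1 - W z)%C).
{ intros z Hz. pose proof (Cexp_log (W z) (HW z Hz)) as E.
  transitivity ((1 - W z) * Cexp (Cps log_coeff (W z)) * Cexp (- Cps log_coeff (W z)))%C.
  - rewrite E. ring.
  - rewrite <- Cmult_assoc, Cexp_opp_r. ring. }
assert (Df : forall z d, Cder L z d -> Cder f z (Cexp (L z) * (1 + z * d))%C).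
{ intros z d D.
  replace (Cexp (L z) * (1 + z * d))%C with (1 * Cexp (L z) + z * (d * Cexp (L z)))%C by ring.
  apply (Cder_mult (fun w => w) (fun w => Cexp (L w))); [apply Cder_id|].
  now apply (Cexp_comp_Cder L). }
assert (AL : analytic_on_disk L)
  by (intros z Hz; destruct (DL z Hz) as [d [D _]]; now exists d).
exists f, (inflate n (fun j => b / 2 * (log_coeff j * k ^ j)))%C.
split; [|split].
- split; [|split].
  + split.
    * intros z Hz. destruct (DL z Hz) as [d [D _]]. exact (ex_intro _ _ (Df z d D)).
    * set (c := inflate n (fun j => RtoC (binom_coeff b j) * k ^ j)%C).
      (* The factor [z] in [f] shifts the coefficients of [Cexp L] by one place. *)
      exists (fun m => match m with O => RtoC 0 | S m => c m end). split; [easy|]. split.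
      -- unfold c. replace O with (n * 0)%nat by lia. rewrite inflate_mul by easy. simpl. ring.
      -- intros z Hz. refine (proj2 (Cis_pseries _ _ _) _). refine (proj1 (Cis_series_S _ _) _).
         replace (f z - 0 * z ^ 0)%C with (z * Cexp (L z))%C by (unfold f; ring).
         apply Cis_series_ext with (fun m => z * (c m * z ^ m))%C; [intros m; simpl; ring|].
         apply Cis_series_scal. unfold c. apply inflate_series; [easy|].
         unfold L. rewrite <- Cps_binom by (try apply HW; easy).
         pose proof (Cmod_ge_0 (W z)).
         eapply Cis_series_ext;
           [|apply (Cps_correct _ (Cmod (W z))); [apply summable_binom; [easy|pose proof (HW
               z Hz); lra]|lra]].
         intros m. unfold W. cbv beta. rewrite Cpow_mult_l. ring.
  + intros z Hz Hz0. apply Cmult_neq_0; [easy|apply Cexp_nz].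
  + exists (fun z => Cexp (RtoC (1 + alpha) * - L z)%C). split.
    * exists (fun z => - L z)%C. split; [|easy]. split; [|split].
      -- intros z Hz. destruct (DL z Hz) as [d [D _]]. exists (- (1) * d)%C.
         apply (is_derive_ext (K := C_AbsRing) (V := C_NormedModule) (fun w => - (1) * L
             w)%C); [intros t; cring|].
         exact (Cder_scal (- (1))%C L z d D).
      -- rewrite L0. ring.
      -- intros z Hz. rewrite Cexp_opp. unfold id_over. destruct (Ceq_dec z (RtoC 0)) as [->|H].
         ++ rewrite L0, Cexp_0. field.
         ++ unfold f. field. split; [apply Cexp_nz|easy].
    * intros z Hz. destruct (DL z Hz) as [d [D Ed]].
      rewrite (is_C_derive_unique f z _ (Df z d D)).
      replace (RtoC (1 + alpha) * - L z)%C with (- L z + - Cps log_coeff (W z))%C.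
      2:{ unfold L, b. rewrite RtoC_plus, RtoC_inv by lra. field. intros E; injection E; lra. }
      rewrite Cexp_plus, EW, Ed by easy.
      replace (Cexp (- L z) * (1 - W z) * (Cexp (L z) * (1 + b * INR n * W z * Cps geom_coeff
          (W z))) - 1)%C
        with (Cexp (L z) * Cexp (- L z) * ((1 - W z) + b * INR n * W z * ((1 - W z) * Cps
            geom_coeff (W z))) - 1)%C by ring.
      rewrite Cexp_opp_r, Cps_geom by (now apply HW).
      replace (1 * (1 - W z + b * INR n * W z * 1) - 1)%C with (lambda * z ^ n)%C.
      -- rewrite Cmod_mult, Cmod_R, Cmod_pow, Rabs_pos_eq by lra.
         assert (Cmod z ^ n < 1)
           by (apply pow_lt_1_compat; [split; [apply Cmod_ge_0|exact Hz]|easy]). nra.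
      (* This fixes [k]: the coefficient [(n / alpha - 1) * k] has to equal [lambda]. *)
      -- unfold W. transitivity (RtoC ((b * INR n - 1) * k) * z ^ n)%C.
         ++ f_equal. f_equal. unfold k, b. field. lra.
         ++ rewrite RtoC_mult, RtoC_minus, RtoC_mult. ring.
- exists L. split; [split; [easy|split; [easy|]]|].
  + intros z Hz. unfold over_id. destruct (Ceq_dec z (RtoC 0)) as [->|H].
    * now rewrite L0, Cexp_0.
    * unfold f. now field.
  + intros z Hz. exists (b / 2 * Cps log_coeff (W z))%C. split.
    2:{ unfold L. field. }
    set (c := inflate n _).
    assert (C0 : c O = RtoC 0).
    { unfold c. replace O with (n * 0)%nat at 1 by lia. rewrite inflate_mul by easy. simpl.
      ring. }
    replace (b / 2 * Cps log_coeff (W z))%C with (b / 2 * Cps log_coeff (W z) - c O * z ^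
        0)%C by (rewrite C0; ring).
    refine (proj2 (Cis_series_S (fun j => c j * z ^ j)%C _) _).
    unfold c. apply inflate_series; [easy|].
    pose proof (Cmod_ge_0 (W z)).
    eapply Cis_series_ext;
      [|apply (Cis_series_scal (b / 2)%C), (Cps_correct log_coeff (Cmod (W z)) (W z)); [apply
          summable_log; pose proof (HW z Hz); lra|lra]].
    intros m. unfold W. cbv beta. rewrite Cpow_mult_l. ring.
- intros j Hj. rewrite inflate_mul by easy. destruct j as [|j]; [lia|]. unfold log_coeff.
  rewrite <- RtoC_pow, <- RtoC_mult, <- RtoC_div, <- RtoC_mult by lra. f_equal. unfold b. field.
  split; [|lra]. apply not_0_INR. lia.
Qed.

(** * Sharp bounds *)

(** The signs on both sides of the root are recorded with uniqueness, since they decide which of two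
    thresholds is smaller. *)
Lemma decreasing_root (p : R -> R) lo hi : continuity p ->
  (forall x y, 0 < x -> x < y -> y < 1 -> p y < p x) ->
  0 < lo -> lo < hi -> hi < 1 -> 0 <= p lo -> p hi < 0 ->
  exists r, (unique_root_01 p r /\ lo <= r < hi) /\
    (forall x, 0 < x <= r -> 0 <= p x) /\ (forall x, r <= x < 1 -> p x <= 0).
Proof.
intros Hc Hd H0 H1 H2 Hlo Hhi.
destruct (IVT_cor p lo hi Hc) as [r [Hr Er]]; [lra|nra|].
assert (Hr' : r < hi) by (destruct (Req_dec r hi) as [->|]; lra).
exists r. split; [split; [split; [split; lra|]|lra]|split].
- intros x Hx Ex. destruct (Rtotal_order x r) as [H|[H|H]]; [|easy|].
  + specialize (Hd x r ltac:(lra) H ltac:(lra)). lra.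
  + specialize (Hd r x ltac:(lra) H ltac:(lra)). lra.
- intros x Hx. destruct (Req_dec x r) as [->|H]; [lra|].
  specialize (Hd x r ltac:(lra) ltac:(lra) ltac:(lra)). lra.
- intros x Hx. destruct (Req_dec x r) as [->|H]; [lra|].
  specialize (Hd r x ltac:(lra) ltac:(lra) ltac:(lra)). lra.
Qed.

Lemma decreasing_of_derive (p dp : R -> R) : (forall x, is_derive p x (dp x)) ->
  (forall x, 0 < x < 1 -> dp x < 0) -> forall x y, 0 < x -> x < y -> y < 1 -> p y < p x.
Proof.
intros D Hd x y Hx Hxy Hy.
destruct (MVT_gen p x y dp) as [c [Hc E]].
- intros; apply D.
- intros z _. apply continuity_pt_filterlim. apply (ex_derive_continuous p). eexists; apply D.
- rewrite Rmin_left, Rmax_right in Hc by lra. specialize (Hd c ltac:(lra)). nra.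
Qed.

(** The quartic is [4 (1-a)^2 ((1-a)^2 + a^2) - a^2 (2-a)^2], nonnegative exactly when
    [lambda_star <= lambda_1]. *)
Lemma root_alpha_1 : exists r,
  (unique_root_01 (fun a => 7 * a ^ 4 - 20 * a ^ 3 + 24 * a ^ 2 - 16 * a + 4) r /\ 0.4825 <=
      r < 0.4826) /\
  (forall x, 0 < x <= r -> 0 <= 7 * x ^ 4 - 20 * x ^ 3 + 24 * x ^ 2 - 16 * x + 4) /\
  (forall x, r <= x < 1 -> 7 * x ^ 4 - 20 * x ^ 3 + 24 * x ^ 2 - 16 * x + 4 <= 0).
Proof.
apply decreasing_root; try lra; [reg|].
apply decreasing_of_derive with (fun a => 4 * (a - 1) * (7 * a ^ 2 - 8 * a + 4)).
- intros x. auto_derive; [easy|ring].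
- intros x Hx. assert (0 < 7 * x ^ 2 - 8 * x + 4) by nra. nra.
Qed.

(** The quartic is [(2-a)^2 ((1-a)^2 + a^2) - 4 a^2 (3-a)^2], nonnegative exactly when
    [lambda_star <= lambda_half]. *)
Lemma root_alpha_half : exists r,
  (unique_root_01 (fun a => 4 - 12 * a - 19 * a ^ 2 + 14 * a ^ 3 - 2 * a ^ 4) r /\ 0.2512 <=
      r < 0.2513) /\
  (forall x, 0 < x <= r -> 0 <= 4 - 12 * x - 19 * x ^ 2 + 14 * x ^ 3 - 2 * x ^ 4) /\
  (forall x, r <= x < 1 -> 4 - 12 * x - 19 * x ^ 2 + 14 * x ^ 3 - 2 * x ^ 4 <= 0).
Proof.
apply decreasing_root; try lra; [reg|].
apply decreasing_of_derive with (fun a => - 12 - 38 * a + 42 * a ^ 2 - 8 * a ^ 3).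
- intros x. auto_derive; [easy|ring].
- intros x Hx. assert (0 < x ^ 3) by (apply pow_lt; lra). nra.
Qed.

(** The cubic is [3 (1-a) ((1-a)^2 + a^2) - a^2 (3-a)], nonnegative exactly when
    [lambda_star <= lambda_nu]. *)
Lemma root_alpha_nu : exists r,
  (unique_root_01 (fun a => 3 - 9 * a + 9 * a ^ 2 - 5 * a ^ 3) r /\ 0.5337 <= r < 0.5338) /\
  (forall x, 0 < x <= r -> 0 <= 3 - 9 * x + 9 * x ^ 2 - 5 * x ^ 3) /\
  (forall x, r <= x < 1 -> 3 - 9 * x + 9 * x ^ 2 - 5 * x ^ 3 <= 0).
Proof.
apply decreasing_root; try lra; [reg|].
apply decreasing_of_derive with (fun a => - 9 + 18 * a - 15 * a ^ 2).
- intros x. auto_derive; [easy|ring].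
- intros x Hx. nra.
Qed.

(** The quadratic is [12 (1-a) (3-a) - (2-a)^2], nonnegative exactly when
    [lambda_half <= lambda_nu]. *)
Lemma root_alpha_2 : exists r,
  (unique_root_01 (fun a => 11 * a ^ 2 - 44 * a + 32) r /\ 0.9555 <= r < 0.9556) /\
  (forall x, 0 < x <= r -> 0 <= 11 * x ^ 2 - 44 * x + 32) /\
  (forall x, r <= x < 1 -> 11 * x ^ 2 - 44 * x + 32 <= 0).
Proof.
apply decreasing_root; try lra; [reg|].
apply decreasing_of_derive with (fun a => 22 * a - 44).
- intros x. auto_derive; [easy|ring].
- intros x Hx. lra.
Qed.

(** * Consequences of the bound by [lambda_star] *)

Lemma le_of_sqr_le x y : 0 <= y -> x ^ 2 <= y ^ 2 -> x <= y.
Proof. intros. nra. Qed.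

Lemma lambda_star_sqr a l : 0 < a < 1 -> 0 < l <= lambda_star a ->
  l ^ 2 * ((1 - a) ^ 2 + a ^ 2) <= (1 - a) ^ 2.
Proof.
intros Ha [Hl H]. unfold lambda_star in H.
set (S := (1 - a) ^ 2 + a ^ 2) in *. assert (HS : 0 < S) by (unfold S; nra).
pose proof (sqrt_lt_R0 S HS). apply Rle_div_r in H; [|easy].
rewrite <- (pow2_sqrt S) by lra. rewrite <- Rpow_mult_distr.
apply pow_incr. split; [apply Rmult_le_pos; lra|easy].
Qed.

(** Squaring removes the root in [lambda_star], so a linear bound on [l] reduces to a polynomial
    inequality in [a]. *)
Lemma lambda_star_le a l u v : 0 < a < 1 -> 0 < l <= lambda_star a -> 0 <= v ->
  u ^ 2 <= v ^ 2 * ((1 - a) ^ 2 + a ^ 2) -> u * l <= v * (1 - a).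
Proof.
intros Ha Hl Hv H. pose proof (lambda_star_sqr a l Ha Hl) as HS.
set (S := (1 - a) ^ 2 + a ^ 2) in *. assert (0 < S) by (unfold S; nra).
apply le_of_sqr_le; [nra|]. apply Rmult_le_reg_r with S; [easy|].
rewrite !Rpow_mult_distr.
apply Rle_trans with (u ^ 2 * (1 - a) ^ 2).
- rewrite Rmult_assoc. apply Rmult_le_compat_l; [apply pow2_ge_0|easy].
- replace (v ^ 2 * (1 - a) ^ 2 * S) with (v ^ 2 * S * (1 - a) ^ 2) by ring.
  apply Rmult_le_compat_r; [apply pow2_ge_0|easy].
Qed.

(** Gives [k < 1] for the extremal functions of every order [n >= 1]. *)
Lemma lambda_star_lt a l : 0 < a < 1 -> 0 < l <= lambda_star a -> a * l < 1 - a.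
Proof.
intros Ha Hl. pose proof (lambda_star_sqr a l Ha Hl) as HS.
apply Rnot_le_lt. intros H.
assert ((1 - a) ^ 2 <= (a * l) ^ 2) by (apply pow_incr; lra).
assert (0 < l ^ 2 * (1 - a) ^ 2) by (apply Rmult_lt_0_compat; apply pow_lt; lra).
nra.
Qed.

(** The triangular system for [l_1, l_2, l_3] is solved after division by [lambda]. The real factors
    of [c1 ^ 2], [c1 * c2] and [c1 ^ 3] are the parameters [t], [mu] and [nu]. *)
Lemma coeff_formulas alpha lambda f gamma : 0 < alpha < 1 -> 0 < lambda ->
  class_U alpha lambda f -> log_coeffs f gamma -> exists c1 c2 c3,
  toeplitz_contraction 1 c1 c2 c3 /\
  gamma 1%nat = (RtoC (lambda / (2 * (1 - alpha))) * c1)%C /\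
  gamma 2%nat = (RtoC (lambda / (2 * (2 - alpha))) *
    (c2 + RtoC (alpha * lambda * (2 - alpha) / (2 * (1 - alpha) ^ 2)) * c1 ^ 2))%C /\
  gamma 3%nat = (RtoC (lambda / (2 * (3 - alpha))) *
    (c3 + RtoC (alpha * lambda * (3 - alpha) / ((1 - alpha) * (2 - alpha))) * c1 * c2
      + RtoC (alpha ^ 2 * lambda ^ 2 * (3 - alpha) / (3 * (1 - alpha) ^ 3)) * c1 ^ 3))%C.
Proof.
intros Ha Hl HU HG. assert (T := class_U_toeplitz alpha lambda f gamma (Rlt_le _ _ Hl) HU HG).
cbv zeta in T.
apply toeplitz_normalize in T; [|easy].
do 3 eexists. split; [exact T|]. clear T.
assert (N : forall x : R, x <> 0 -> RtoC x <> RtoC 0) by (intros x Hx E; injection E; easy).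
assert (N1 := N (1 - alpha) ltac:(lra)). assert (N2 := N (2 - alpha) ltac:(lra)).
assert (N3 := N (3 - alpha) ltac:(lra)).
assert (N0 := N lambda ltac:(lra)).
assert (P1 : (1 - alpha) ^ 2 <> 0) by (apply pow_nonzero; lra).
assert (P2 : (1 - alpha) ^ 3 <> 0) by (apply pow_nonzero; lra).
assert (P3 : (1 - alpha) * (2 - alpha) <> 0)
  by (apply Rmult_integral_contrapositive_currified; lra).
rewrite !RtoC_div by lra. rewrite !RtoC_mult, !RtoC_pow.  rewrite !RtoC_minus in *.
repeat split; field; repeat split; try easy; apply N; lra.
Qed.

Lemma bound_of_formula (x : C) (b m : R) y : 0 <= b -> Cmod y <= m -> x = (RtoC b * y)%C ->
  Cmod x <= b * m.
Proof.
intros Hb Hy ->. rewrite Cmod_mult, Cmod_R, Rabs_pos_eq by easy. now apply Rmult_le_compat_l.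
Qed.

Lemma extremal_lower_bound alpha lambda n j M : 0 < alpha < 1 -> 0 < lambda -> (0 < n)%nat ->
  (0 < j)%nat ->
  alpha * lambda < 1 - alpha -> coeff_bound alpha lambda (n * j) M ->
  (alpha * lambda / (INR n - alpha)) ^ j / (2 * alpha * INR j) <= M.
Proof.
intros Ha Hl Hn Hj H HM.
assert (Hn1 : 1 <= INR n) by (apply (le_INR 1); lia).
destruct (extremal_function alpha lambda n Ha Hl Hn) as [f [gamma [HU [HG E]]]].
{ apply Rlt_div_l; lra. }
specialize (HM f gamma HU HG). rewrite E, Cmod_R in HM by easy.
eapply Rle_trans; [apply Rle_abs|exact HM].
Qed.

(** * Sharp estimates for each coefficient *)

Lemma best_1 a l : 0 < a < 1 -> 0 < l <= lambda_star a ->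
  best_coeff_bound a l 1 (l / (2 * (1 - a))).
Proof.
intros Ha Hl. split.
- intros f gamma HU HG.
  destruct (coeff_formulas a l f gamma Ha (proj1 Hl) HU HG) as [c1 [c2 [c3 [T [E _]]]]].
  rewrite <- (Rmult_1_r (l / _)).
  apply (bound_of_formula _ _ _ c1); [apply Rdiv_le_0_compat; lra| |easy].
  pose proof (toeplitz_bessel _ _ _ T). pose proof (pow2_ge_0 (Cmod c2)).
  pose proof (pow2_ge_0 (Cmod c3)).
  apply pow2_le_1; [apply Cmod_ge_0|lra].
- intros M HM.
  apply (extremal_lower_bound a l 1 1) in HM; try lia; try lra; [|now apply lambda_star_lt].
  replace (l / _) with ((a * l / (INR 1 - a)) ^ 1 / (2 * a * INR 1)); [easy|]. simpl. field.
  lra.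
Qed.

(** The maximum covers both cases at once: its first entry is attained with [n = 2, j = 1], its
    second with [n = 1, j = 2]. *)
Lemma best_2 a l : 0 < a < 1 -> 0 < l <= lambda_star a ->
  best_coeff_bound a l 2 (l / (2 * (2 - a)) * Rmax 1 (a * l * (2 - a) / (2 * (1 - a) ^ 2))).
Proof.
intros Ha Hl. split.
- intros f gamma HU HG.
  destruct (coeff_formulas a l f gamma Ha (proj1 Hl) HU HG) as [c1 [c2 [c3 [T [_ [E _]]]]]].
  apply bound_of_formula with (3 := E); [apply Rdiv_le_0_compat; lra|].
  apply fekete_szego with c3; [easy|].
  apply Rdiv_le_0_compat; [repeat apply Rmult_le_pos; lra|].
  apply Rmult_lt_0_compat; [lra|]. apply pow_lt; lra.
- intros M HM. apply Rmax_case.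
  + apply (extremal_lower_bound a l 2 1) in HM; try lia; try lra; [|now apply lambda_star_lt].
    replace (l / _ * _) with ((a * l / (INR 2 - a)) ^ 1 / (2 * a * INR 1)); [easy|]. simpl.
    field. lra.
  + apply (extremal_lower_bound a l 1 2) in HM; try lia; try lra; [|now apply lambda_star_lt].
    replace (l / _ * _) with ((a * l / (INR 1 - a)) ^ 2 / (2 * a * INR 2)); [easy|]. simpl.
    field. lra.
Qed.

(** The two inequalities assumed say [mu <= 1] and [nu <= 1] with denominators cleared. *)
Lemma best_3_small a l : 0 < a < 1 -> 0 < l <= lambda_star a ->
  a * l * (3 - a) <= (1 - a) * (2 - a) -> a ^ 2 * l ^ 2 * (3 - a) <= 3 * (1 - a) ^ 3 ->
  best_coeff_bound a l 3 (l / (2 * (3 - a))).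
Proof.
intros Ha Hl Hm Hn. assert (P3 : 0 < (1 - a) ^ 3) by (apply pow_lt; lra).
split.
- intros f gamma HU HG.
  destruct (coeff_formulas a l f gamma Ha (proj1 Hl) HU HG) as [c1 [c2 [c3 [T [_ [_ E]]]]]].
  rewrite <- (Rmult_1_r (l / _)).
  apply bound_of_formula with (3 := E); [apply Rdiv_le_0_compat; lra|].
  apply prokhorov_szynal_small; [easy|split|split].
  + apply Rdiv_le_0_compat; [repeat apply Rmult_le_pos; lra|nra].
  + apply Rle_div_l; [nra|lra].
  + apply Rdiv_le_0_compat; [repeat apply Rmult_le_pos; try apply pow2_ge_0; lra|lra].
  + apply Rle_div_l; lra.
- intros M HM.
  apply (extremal_lower_bound a l 3 1) in HM; try lia; try lra; [|now apply lambda_star_lt].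
  replace (l / _) with ((a * l / (INR 3 - a)) ^ 1 / (2 * a * INR 1)); [easy|]. simpl. field.
  lra.
Qed.

Lemma best_3_large a l : 0 < a < 1 -> 0 < l <= lambda_star a ->
  3 * (1 - a) ^ 3 <= a ^ 2 * l ^ 2 * (3 - a) ->
  best_coeff_bound a l 3 (a ^ 2 * l ^ 3 / (6 * (1 - a) ^ 3)).
Proof.
intros Ha Hl Hn. assert (P3 : 0 < (1 - a) ^ 3) by (apply pow_lt; lra).
split.
- intros f gamma HU HG.
  destruct (coeff_formulas a l f gamma Ha (proj1 Hl) HU HG) as [c1 [c2 [c3 [T [_ [_ E]]]]]].
  replace (a ^ 2 * l ^ 3 / _) with (l / (2 * (3 - a)) * (a ^ 2 * l ^ 2 * (3 - a) / (3 * (1 -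
      a) ^ 3))) by (field; lra).
  apply bound_of_formula with (3 := E); [apply Rdiv_le_0_compat; lra|].
  apply prokhorov_szynal_large; [easy|split|].
  + apply Rdiv_le_0_compat; [repeat apply Rmult_le_pos; lra|nra].
  + apply Rle_div_l; [nra|].
    assert (H := lambda_star_le a l (a * (3 - a)) (2 * (2 - a)) Ha Hl ltac:(lra)).
    enough ((a * (3 - a)) ^ 2 <= (2 * (2 - a)) ^ 2 * ((1 - a) ^ 2 + a ^ 2))
      by (specialize (H H0); lra).
    (* This is [mu <= 2] after squaring: [4 (2-a)^2 ((1-a)^2 + a^2) - a^2 (3-a)^2] vanishes at
       [a = 1], which yields the factor [1 - a]. *)
    enough (0 <= (1 - a) * (16 - 32 * a + 27 * a ^ 2 - 7 * a ^ 3)) by lra.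
    apply Rmult_le_pos; [lra|]. nra.
  + apply Rle_div_r; lra.
- intros M HM.
  apply (extremal_lower_bound a l 1 3) in HM; try lia; try lra; [|now apply lambda_star_lt].
  replace (a ^ 2 * l ^ 3 / _) with ((a * l / (INR 1 - a)) ^ 3 / (2 * a * INR 3)); [easy|].
  simpl. field. lra.
Qed.

Lemma lambda_nu_sqr a : 0 < a < 1 ->
  0 <= lambda_nu a /\ a ^ 2 * lambda_nu a ^ 2 * (3 - a) = 3 * (1 - a) ^ 3.
Proof.
intros Ha. split; [apply sqrt_pos|]. unfold lambda_nu. rewrite pow2_sqrt; [field; lra|].
apply Rdiv_le_0_compat; [apply Rmult_le_pos; [lra|apply pow_le; lra]|].
apply Rmult_lt_0_compat; [apply pow_lt|]; lra.
Qed.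

Theorem theorem1 :
  exists alpha_1 alpha_half alpha_nu alpha_2 : R,
    (unique_root_01
       (fun a => 7 * a ^ 4 - 20 * a ^ 3 + 24 * a ^ 2 - 16 * a + 4) alpha_1 /\
     0.4825 <= alpha_1 < 0.4826) /\
    (unique_root_01
       (fun a => 4 - 12 * a - 19 * a ^ 2 + 14 * a ^ 3 - 2 * a ^ 4) alpha_half /\
     0.2512 <= alpha_half < 0.2513) /\
    (unique_root_01
       (fun a => 3 - 9 * a + 9 * a ^ 2 - 5 * a ^ 3) alpha_nu /\
     0.5337 <= alpha_nu < 0.5338) /\
    (unique_root_01
       (fun a => 11 * a ^ 2 - 44 * a + 32) alpha_2 /\
     0.9555 <= alpha_2 < 0.9556) /\
    forall alpha lambda : R,
      0 < alpha < 1 ->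
      0 < lambda <= lambda_star alpha ->
      best_coeff_bound alpha lambda 1 (lambda / (2 * (1 - alpha))) /\
      ((alpha_1 <= alpha < 1 /\ 0 < lambda <= lambda_1 alpha) \/
       (0 < alpha <= alpha_1 /\ 0 < lambda <= lambda_star alpha) ->
       best_coeff_bound alpha lambda 2 (lambda / (2 * (2 - alpha)))) /\
      (alpha_1 <= alpha < 1 /\ lambda_1 alpha <= lambda <= lambda_star alpha ->
       best_coeff_bound alpha lambda 2
         (alpha * lambda ^ 2 / (4 * (1 - alpha) ^ 2))) /\
      ((0 < alpha <= alpha_half /\ 0 < lambda <= lambda_star alpha) \/
       (alpha_half <= alpha <= alpha_2 /\ 0 < lambda <= lambda_half alpha) \/
       (alpha_2 <= alpha < 1 /\ 0 < lambda <= lambda_nu alpha) ->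
       best_coeff_bound alpha lambda 3 (lambda / (2 * (3 - alpha)))) /\
      (alpha_nu <= alpha < 1 /\ lambda_nu alpha <= lambda <= lambda_star alpha ->
       best_coeff_bound alpha lambda 3
         (alpha ^ 2 * lambda ^ 3 / (6 * (1 - alpha) ^ 3))).
Proof.
destruct root_alpha_1 as [a1 [R1 [S1 _]]]. destruct root_alpha_half as [ah [Rh [Sh _]]].
destruct root_alpha_nu as [an [Rn _]]. destruct root_alpha_2 as [a2 [R2 [S2 S2']]].
exists a1, ah, an, a2. do 4 (split; [assumption|]).
intros a l Ha Hl.
assert (P2 : 0 < (1 - a) ^ 2) by (apply pow_lt; lra).
assert (Q1 : 0 < a * (2 - a)) by nra.
assert (Q2 : 0 < 2 * a * (3 - a)) by nra.
split; [now apply best_1|]. split; [|split; [|split]].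
- intros H. pose proof (best_2 a l Ha Hl) as B. rewrite Rmax_left, Rmult_1_r in B; [exact B|].
  apply Rle_div_l; [lra|]. destruct H as [[_ [_ H]]|[H _]].
  + unfold lambda_1 in H. apply Rle_div_r in H; [lra|easy].
  + assert (K := lambda_star_le a l (a * (2 - a)) (2 * (1 - a)) Ha Hl ltac:(lra)).
    specialize (S1 a H).
    enough ((a * (2 - a)) ^ 2 <= (2 * (1 - a)) ^ 2 * ((1 - a) ^ 2 + a ^ 2))
      by (specialize (K H0); lra).
    lra.
- intros [_ [H _]]. pose proof (best_2 a l Ha Hl) as B. rewrite Rmax_right in B.
  + replace (a * l ^ 2 / _) with (l / (2 * (2 - a)) * (a * l * (2 - a) / (2 * (1 - a) ^ 2)))
      by (field; lra). exact B.
  + unfold lambda_1 in H. apply Rle_div_l in H; [|easy]. apply Rle_div_r; lra.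
- intros H.
  (* All three ranges lead to [mu <= 1/2] and [nu <= 1]. *)
  assert (K : 2 * a * (3 - a) * l <= (1 - a) * (2 - a) /\ a ^ 2 * l ^ 2 * (3 - a) <= 3 * (1 - a) ^ 3).
  { assert (P : 2 * a * (3 - a) * l <= (1 - a) * (2 - a) -> 0 <= 11 * a ^ 2 - 44 * a + 32 ->
      a ^ 2 * l ^ 2 * (3 - a) <= 3 * (1 - a) ^ 3).
    { intros K1 K2.
      assert (K3 : (2 * a * (3 - a) * l) ^ 2 <= ((1 - a) * (2 - a)) ^ 2).
      { apply pow_incr. split; [apply Rmult_le_pos; lra|easy]. }
      (* After this scaling the gap in [nu <= 1] is at least [12 (3-a) (1-a)^3 - (1-a)^2 (2-a)^2],
         that is [(1-a)^2] times the quadratic. *)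
      apply Rmult_le_reg_l with (4 * (3 - a)); [lra|].
      assert (0 <= (1 - a) ^ 2 * (11 * a ^ 2 - 44 * a + 32)) by (apply Rmult_le_pos; lra).
      lra. }
    destruct H as [[H _]|[[H [_ H']]|[H [_ H']]]].
    - assert (K1 : 2 * a * (3 - a) * l <= (1 - a) * (2 - a)).
      { rewrite (Rmult_comm (1 - a)). apply lambda_star_le; try easy; [lra|].
        specialize (Sh a H). lra. }
      (* The decimal enclosures put the root [ah] below [a2]. *)
      split; [easy|]. apply P; [easy|]. apply S2. lra.
    - assert (K1 : 2 * a * (3 - a) * l <= (1 - a) * (2 - a)).
      { unfold lambda_half in H'. apply Rle_div_r in H'; lra. }
      split; [easy|]. apply P; [easy|]. apply S2. lra.
    - destruct (lambda_nu_sqr a Ha) as [L0 L1].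
      assert (K1 : a ^ 2 * l ^ 2 * (3 - a) <= 3 * (1 - a) ^ 3).
      { rewrite <- L1. apply Rmult_le_compat_r; [lra|].
        apply Rmult_le_compat_l; [apply pow2_ge_0|].
        apply pow_incr. lra. }
      (* Beyond [a2] the quadratic is nonpositive and the implication reverses: [nu <= 1] now yields
         [mu <= 1/2]. *)
      split; [|easy]. apply le_of_sqr_le; [apply Rmult_le_pos; lra|].
      specialize (S2' a H).
      assert (0 <= (1 - a) ^ 2 * - (11 * a ^ 2 - 44 * a + 32)) by (apply Rmult_le_pos; lra).
      apply (Rmult_le_compat_l (4 * (3 - a))) in K1; lra. }
  destruct K as [K1 K2]. apply best_3_small; try easy. lra.
- intros [_ [H _]]. apply best_3_large; try easy.
  destruct (lambda_nu_sqr a Ha) as [L0 L1]. rewrite <- L1.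
  apply Rmult_le_compat_r; [lra|]. apply Rmult_le_compat_l; [apply pow2_ge_0|].
  apply pow_incr. lra.
Qed.
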